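(* Let $n\ge 2$ and $1\le k\le n-1$. There is an $(n-1)$-resilient algorithm that solves $k$-set agreement with failure detector $(\Sigma_k,\Omega_k)$ in an asynchronous system of $n$ processes if and only if $k=1$ or $k=n-1$.
   Context: Processes and runs. $\Pi=\{p_1,\dots,p_n\}$ is a set of $n$ processes with unique ids $1,\dots,n$ communicating by message passing, with messages from a (possibly infinite) universe $M$. Each process has a message buffer containing the messages sent to it but not yet received. Each process $p$ is a deterministic state machine whose local state contains an input (proposal) value $x_p$ from a finite set $V$ with $|V|\ge n$, and a write-once output (decision) value $y_p\in V\cup\{\bot\}$, initially $\bot\notin V$; all other components are initialized to fixed values. In a step, a process atomically takes its current local state, a (possibly empty) subset $L$ of the messages in its buffer, and the value obtained by querying the failure detector, and moves to a new local state according to the transition relation; a deterministic message sending function maps the current state and $L$ to a subset of $\Pi\times M$, and each $(q,m)$ in it is sent by placing $m$ in $q$'s buffer. A configuration is the vector of local states together with all message buffers; initially all processes are in initial states and all buffers are empty. A run is an infinite sequence of configurations $(C_0,C_1,\dots)$ starting from an initial configuration, where $C_i$ results from $C_{i-1}$ by a legitimate step of a single process (the $i$th step, occurring at time $i$). Processes have no access to time. Asynchronous system. Every correct process takes infinitely many steps; faulty (crashing) processes take only finitely many steps and may omit sending messages to a subset of the receivers in their very last step; every message sent to a correct process is eventually received. There are no bounds on process speeds or message delays. An $(n-1)$-resilient algorithm must work in all admissible runs with at most $n-1$ faulty processes. Failure detectors. The failure pattern $F(\cdot)$ of a run gives the set $F(t)$ of processes crashed at time $t$: $p\in F(t)$ iff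 there is no $i\ge t$ such that the $i$th step is a step of $p$. The set of faulty processes is $F=\bigcup_{t\ge 0}F(t)$. A failure detector assigns to each failure pattern a set of admissible histories; a history $H(p,t)$ is the value returned to a query by $p$ at time $t$. A run is admissible if all steps use the values of some history admissible for its failure pattern. $\Sigma_k$: $H(p,t)$ is a set of process ids such that (Intersection) for every set of $k+1$ processes $\{p_1,\dots,p_{k+1}\}$ and all times $t_1,\dots,t_{k+1}$ there are indices $1\le i\ne j\le k+1$ with $H(p_i,t_i)\cap H(p_j,t_j)\ne\emptyset$; (Liveness) $\exists t\,\forall t'\ge t\,\forall p_i\notin F:\ H(p_i,t')\cap F=\emptyset$. By convention, if $p\in F(t)$ then $H(p,t')=\Pi$ for all $t'\ge t$. $\Omega_k$ ($1\le k\le n-1$): (Validity) for all $p,t$, $H(p,t)$ is a set of $k$ process ids; (Eventual Leadership) there exist a time $t_{\mathrm{GST}}$ and a set $LD$ with $LD\cap(\Pi\setminus F)\ne\emptyset$ and $H(p,t)=LD$ for all $t\ge t_{\mathrm{GST}}$ and all $p$. The failure detector $(\Sigma_k,\Omega_k)$ outputs pairs, the first component satisfying $\Sigma_k$ and the second $\Omega_k$. $k$-set agreement. An algorithm solves $k$-set agreement if in all its admissible runs: ($k$-Agreement) processes (correct or faulty) decide on at most $k$ different values; (Validity) if a process decides on $v$, then $v$ was proposed by some process; (Termination) every correct process eventually decides, i.e. irrevocably sets its output. *)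

(* Defs.v *)
(* [set T] (from classical_sets) is an arbitrary, possibly infinite, subset
   T -> Prop; [{set T}] is a finite set over a finite type. *)
From mathcomp Require Import boolp classical_sets.
From mathcomp Require Import all_boot.

Set Implicit Arguments.
Unset Strict Implicit.
Unset Printing Implicit Defensive.

(* [None] is the undecided value bottom. *)
Record lstate (V S : Type) : Type := LState {
  input : V;
  output : option V;
  aux : S }.

(* The processes p_1, ..., p_n are the elements of 'I_n. The transition and
   sending functions depend on the process, since ids are known. As the value
   sent depends only on the state before the step and on the received messages,
   [send] takes no failure detector value. Buffers and sent messages are plain
   sets: an algorithm that must tell apart two copies of a message can put
   sender ids and sequence numbers into it. *)
Record algorithm (n : nat) (V : finType) (D : Type) : Type := Algorithm {
  msg : Type;
  astate : Type;
  init_aux : 'I_n -> astate;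
  trans : 'I_n -> lstate V astate -> set msg -> D -> lstate V astate;
  send : 'I_n -> lstate V astate -> set msg -> set ('I_n * msg);
  output_write_once : forall p s L d v,
    output s = Some v -> output (trans p s L d) = Some v }.

Section Executions.
Variables (n : nat) (V : finType) (D : Type) (A : algorithm n V D).

Record config : Type := Config {
  local : 'I_n -> lstate V (astate A);
  buffer : 'I_n -> set (msg A) }.

(* [omitted] is the set of receivers to which the messages of the step are not
   sent; [is_run] allows it to be nonempty only in a last step. *)
Record step : Type := Step {
  actor : 'I_n;
  received : set (msg A);
  fd_value : D;
  omitted : {set 'I_n} }.

Definition initial (C : config) : Prop :=
  forall p, output (local C p) = None /\
            aux (local C p) = init_aux A p /\
            buffer C p = (fun=> False).

Definition sent (C : config) (e : step) (q : 'I_n) : set (msg A) :=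
  fun m => send (actor e) (local C (actor e)) (received e) (q, m) /\
           q \notin omitted e.

Definition next_config (C : config) (e : step) : config :=
  Config
    (fun p => if p == actor e
              then trans p (local C p) (received e) (fd_value e)
              else local C p)
    (fun p m => (buffer C p m /\ ~ (p = actor e /\ received e m)) \/
                sent C e p m).

(* [ev i] is the step leading from [conf i] to [conf i.+1]; it is the
   (i+1)-th step of the run and occurs at time i+1. *)
Record execution : Type := Execution {
  conf : nat -> config;
  ev : nat -> step }.

Definition is_run (r : execution) : Prop :=
  initial (conf r 0) /\
  forall i,
    (forall m, received (ev r i) m -> buffer (conf r i) (actor (ev r i)) m) /\
    conf r i.+1 = next_config (conf r i) (ev r i) /\
    (omitted (ev r i) != finset.set0 ->
       forall j, i < j -> actor (ev r j) <> actor (ev r i)).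

End Executions.

Definition failure_pattern (n : nat) := nat -> {set 'I_n}.
Definition history (n : nat) (D : Type) := 'I_n -> nat -> D.
Definition failure_detector (n : nat) (D : Type) :=
  failure_pattern n -> history n D -> Prop.

Definition faulty (n : nat) (F : failure_pattern n) : {set 'I_n} :=
  [set p | `[< exists t, p \in F t >]]%SET.

(* The step at time i+1 is [ev r i]. *)
Definition pattern_of (n : nat) (V : finType) (D : Type)
    (A : algorithm n V D) (r : execution A) : failure_pattern n :=
  fun t => [set p | `[< ~ exists i, t <= i.+1 /\ actor (ev r i) = p >]]%SET.

(* [tau] assigns a time to every process; only its values on [Q] matter. *)
Definition Sigma (n k : nat) : failure_detector n {set 'I_n} :=
  fun F H =>
    (forall (Q : {set 'I_n}) (tau : 'I_n -> nat), #|Q| = k.+1 ->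
       exists p q, p \in Q /\ q \in Q /\ p <> q /\
                   H p (tau p) :&: H q (tau q) <> finset.set0) /\
    (exists t, forall t' p, t <= t' -> p \notin faulty F ->
       H p t' :&: faulty F = finset.set0) /\
    (forall p t t', p \in F t -> t <= t' -> H p t' = [set: 'I_n]%SET).

Definition Omega (n k : nat) : failure_detector n {set 'I_n} :=
  fun F H =>
    (forall p t, #|H p t| = k) /\
    (exists (tGST : nat) (LD : {set 'I_n}),
       LD :&: ~: faulty F <> finset.set0 /\
       forall t p, tGST <= t -> H p t = LD).

Definition fd_pair (n : nat) (D1 D2 : Type)
    (X1 : failure_detector n D1) (X2 : failure_detector n D2) :
    failure_detector n (D1 * D2) :=
  fun F H => X1 F (fun p t => (H p t).1) /\ X2 F (fun p t => (H p t).2).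

(* Correct processes take infinitely many steps by definition of
   [pattern_of]; what remains is the bound on the number of faulty processes,
   reliable delivery to correct processes and the failure detector. *)
Definition admissible (n : nat) (V : finType) (D : Type) (f : nat)
    (X : failure_detector n D) (A : algorithm n V D) (r : execution A) : Prop :=
  let F := pattern_of r in
  is_run r /\
  #|faulty F| <= f /\
  (forall i q m, q \notin faulty F -> sent (conf r i) (ev r i) q m ->
     exists j, i < j /\ actor (ev r j) = q /\ received (ev r j) m) /\
  (exists H : history n D, X F H /\
     forall i, fd_value (ev r i) = H (actor (ev r i)) i.+1).

Definition decides (n : nat) (V : finType) (D : Type) (A : algorithm n V D)
    (r : execution A) (p : 'I_n) (v : V) : Prop :=
  exists i, output (local (conf r i) p) = Some v.

(* Irrevocability of decisions is [output_write_once]. *)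
Definition solves_set_agreement (n : nat) (V : finType) (D : Type) (f k : nat)
    (X : failure_detector n D) (A : algorithm n V D) : Prop :=
  forall r : execution A, admissible f X r ->
    #|[set v : V | `[< exists p, decides r p v >]]%SET| <= k /\
    (forall p v, decides r p v -> exists q, input (local (conf r 0) q) = v) /\
    (forall p, p \notin faulty (pattern_of r) -> exists v, decides r p v).

(* Main.v *)
(* Impossibility for [2 <= k <= n - 2]. Fix a core of the [n - k + 1 >= 3]
   processes with the largest ids. If the quorums of core processes are the
   core minus one process, those of any other process are that process alone,
   and crashed processes output everything, then Sigma_k's intersection property
   holds, since two of any [k + 1] processes are in the core. Each of the [k - 1]
   processes outside the core can be made to decide its own input in isolation,
   so the core cannot decide two values in a run in which it does not hear from
   the others. Two leaders inside the core are enough for Omega_k if at most one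
   core process crashes, hence the core would solve consensus despite one crash
   with failure detector values that carry no information, which is refuted as
   by Fischer, Lynch and Paterson.

   For [k = n - 1] the quorums are used only to detect loneliness: a process
   decides its own input if its quorum contains no other process, and otherwise
   adopts the input of a process with smaller id or any decided value. For
   [k = 1], Paxos is run with gossip: every process repeatedly reports its
   current ballot and its last vote, and adopts larger ballots and the votes cast
   in its current ballot; the leader given by Omega_1 opens new ballots. *)
From mathcomp Require Import boolp classical_sets.
From mathcomp Require Import all_boot zify.
Require Import Defs.

Set Implicit Arguments.
Unset Strict Implicit.
Unset Printing Implicit Defensive.

(** * Finite schedules and fair extensions *)

Section Schedules.
Variables (n : nat) (V : finType) (D : Type) (A : algorithm n V D).
Implicit Types (C : config A) (e : step A) (s : seq (step A)).
Implicit Types (P : {set 'I_n}) (ok : step A -> Prop).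

Definition enabled C e : Prop :=
  forall m, received e m -> buffer C (actor e) m.

Definition exec C s : config A := foldl (@next_config n V D A) C s.

(** Since nothing is omitted, no step of a schedule has to be the last one of its process, and every
    process may act again afterwards. *)
Fixpoint sched ok C s : Prop :=
  if s is e :: s' then
    [/\ ok e, enabled C e, omitted e = finset.set0 & sched ok (next_config C e) s']
  else True.

Lemma exec_cat C s1 s2 : exec C (s1 ++ s2) = exec (exec C s1) s2.
Proof. exact: foldl_cat. Qed.

Lemma sched_cat ok C s1 s2 :
  sched ok C (s1 ++ s2) <-> sched ok C s1 /\ sched ok (exec C s1) s2.
Proof.
elim: s1 C => [|e s1 IH] C /=; first by split=> [|[]].
split=> [[? ? ? /IH[? ?]]|[[? ? ? ?] ?]]; first by [].
by split=> //; apply/IH.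
Qed.

Lemma sched_impl ok ok' C s :
  (forall e, ok e -> ok' e) -> sched ok C s -> sched ok' C s.
Proof.
by move=> h; elim: s C => //= e s IH C [/h ? ? ? /IH].
Qed.

Lemma sched_take ok C s i : sched ok C s -> sched ok C (take i s).
Proof. by rewrite -{1}(cat_take_drop i s) => /sched_cat[]. Qed.

Lemma sched_nth ok C s e0 i : sched ok C s -> i < size s ->
  [/\ ok (nth e0 s i), enabled (exec C (take i s)) (nth e0 s i) &
      omitted (nth e0 s i) = finset.set0].
Proof.
elim: s C i => //= e s IH C [|i] [? ? ? hs] //= hi.
exact: IH.
Qed.

Lemma output_step C e p v :
  output (local C p) = Some v -> output (local (next_config C e) p) = Some v.
Proof. by rewrite /=; case: ifP => // _; apply: output_write_once. Qed.

Lemma output_exec C s p v :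
  output (local C p) = Some v -> output (local (exec C s) p) = Some v.
Proof. by elim: s C => //= e s IH C /(output_step e)/IH. Qed.

(** Indistinguishability for the processes in [P]. Inclusion of buffers is enough to replay steps,
    because a step need not empty the buffer, and it is preserved when a process outside [P] acts,
    which can only add messages for [P]. *)
Definition cle P C C' : Prop :=
  forall p, p \in P ->
    local C p = local C' p /\ forall m, buffer C p m -> buffer C' p m.

Lemma cle_step P C C' e : cle P C C' -> actor e \in P ->
  cle P (next_config C e) (next_config C' e).
Proof.
move=> h he p hp; have [hl hb] := h p hp; have [hle _] := h _ he.
split=> [|m] /=; first by rewrite hl.
by rewrite /sent hle => -[[/hb]|]; [left|right].
Qed.

Lemma cle_sched P ok C C' s : (forall e, ok e -> actor e \in P) ->
  cle P C C' -> sched ok C s -> sched ok C' s /\ cle P (exec C s) (exec C' s).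
Proof.
move=> hok; elim: s C C' => [//|e s IH] C C' h /= [h1 h2 h3 h4].
have he := hok _ h1.
have [h5 h6] := IH _ _ (cle_step h he) h4.
by split=> //; split=> // m /h2 /(proj2 (h _ he)).
Qed.

Lemma cle_trans P C1 C2 C3 : cle P C1 C2 -> cle P C2 C3 -> cle P C1 C3.
Proof.
move=> h1 h2 p hp; have [a b] := h1 p hp; have [c d] := h2 p hp.
by split; [rewrite a|move=> m /b /d].
Qed.

Lemma cle_other_step P C e : actor e \notin P -> cle P C (next_config C e).
Proof.
move=> he p hp; have hpe : p <> actor e by move=> q; rewrite -q hp in he.
by split=> [|m hm] /=; [case: eqP|left; split=> // -[]].
Qed.

Lemma local_idle ok C s p : (forall e, ok e -> actor e <> p) ->
  sched ok C s -> local (exec C s) p = local C p.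
Proof.
move=> hok; elim: s C => //= e s IH C [/hok he _ _ /IH ->] /=.
by case: eqP => // h; case: he.
Qed.

Fixpoint serves C (p : 'I_n) s (m : msg A) : Prop :=
  if s is e :: s' then
    (actor e = p /\ received e m) \/ serves (next_config C e) p s' m
  else False.

Lemma buffer_exec C s p m : buffer C p m ->
  serves C p s m \/ buffer (exec C s) p m.
Proof.
elim: s C => [|e s IH] C hm /=; first by right.
case: (pselect (actor e = p /\ received e m)) => [h|h]; first by left; left.
have /IH[h'|h'] : buffer (next_config C e) p m.
- by left; split=> // -[h1 h2]; apply: h.
- by left; right.
- by right.
Qed.

Lemma serves_cat C p s1 s2 m :
  serves C p (s1 ++ s2) m <-> serves C p s1 m \/ serves (exec C s1) p s2 m.
Proof.
elim: s1 C => [|e s1 IH] C /=; first by split; [right|case].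
by rewrite IH; tauto.
Qed.

Lemma serves_nth e0 C p s m : serves C p s m ->
  exists i, [/\ i < size s, actor (nth e0 s i) = p & received (nth e0 s i) m].
Proof.
elim: s C => [//|e s IH] C /= [[h1 h2]|/IH[i [h1 h2 h3]]]; first by exists 0.
by exists i.+1.
Qed.

(** The unit of which fair runs are made: [p] makes progress, and all messages waiting for it at the
    start are delivered. *)
Definition fair_segment ok C p s : Prop :=
  [/\ sched ok C s,
      (exists s' e, s = rcons s' e /\ actor e = p) &
      forall m, buffer C p m -> serves C p s m].

Section FairRun.
Variables (C0 : config A) (s0 : seq (step A)) (P : {set 'I_n}) (p0 : 'I_n).
Variables (ok0 ok : step A -> Prop) (Inv : config A -> Prop).
Hypotheses (hp0 : p0 \in P) (hs0 : sched ok0 C0 s0) (hI : Inv (exec C0 s0)).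
Hypothesis hstep : forall C p, Inv C -> p \in P ->
  exists s, fair_segment ok C p s /\ Inv (exec C s).

(** Segments for the processes in [P] are appended to [s0] in round-robin order, and [Inv] holds at
    the boundaries between them. *)
Lemma fair_extension : exists e : nat -> step A,
  let conf i := exec C0 (mkseq e i) in
  [/\ (forall i, enabled (conf i) (e i) /\ omitted (e i) = finset.set0),
      mkseq e (size s0) = s0,
      (forall i, size s0 <= i -> ok (e i) /\
        exists s, mkseq e i = s0 ++ s /\ sched ok (exec C0 s0) s),
      (forall p i, p \in P -> exists2 j, i <= j & actor (e j) = p) /\
      (forall p i m, p \in P -> buffer (conf i) p m ->
        exists j, [/\ i <= j, actor (e j) = p & received (e j) m]) &
      forall i, exists2 j, i <= j & Inv (conf j)].
Proof.
have /choice[f hf] : forall x : config A * 'I_n, exists s,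
    Inv x.1 -> x.2 \in P -> fair_segment ok x.1 x.2 s /\ Inv (exec x.1 s).
  move=> [C p]; case: (pselect (Inv C /\ p \in P)) => [[h1 h2]|h].
    by have [s hs] := hstep h1 h2; exists s.
  by exists [::] => h1 h2; case: h.
pose pick m := nth p0 (enum P) (m %% #|P|).
have hP : 0 < #|P| by apply/card_gt0P; exists p0.
have pickP m : pick m \in P.
  by rewrite -mem_enum mem_nth // -cardE ltn_mod.
have pick_inf p m : p \in P -> exists2 m', m <= m' & pick m' = p.
  move=> hp; exists (m * #|P| + index p (enum P)).
    by apply: leq_trans (leq_addr _ _); rewrite leq_pmulr.
  have hi : index p (enum P) < #|P| by rewrite cardE index_mem mem_enum.
  by rewrite /pick modnMDl modn_small // nth_index // mem_enum.
pose pre := fix pre m := if m is m'.+1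
  then pre m' ++ f (exec C0 (pre m'), pick m') else s0.
have preS m : pre m.+1 = pre m ++ f (exec C0 (pre m), pick m) by [].
have preI m : Inv (exec C0 (pre m)).
  elim: m => //= m IH; rewrite exec_cat.
  by have [] := hf (_, _) IH (pickP m).
have preF m := (hf (_, _) (preI m) (pickP m)).1.
have pre_sched m : exists s, pre m = s0 ++ s /\ sched ok (exec C0 s0) s.
  elim: m => [|m [s [h1 h2]]]; first by exists [::]; rewrite cats0.
  exists (s ++ f (exec C0 (pre m), pick m)); rewrite preS {1}h1 catA; split=> //.
  apply/sched_cat; split=> //; rewrite -exec_cat -h1.
  by case: (preF m).
have size_pre m : size s0 + m <= size (pre m).
  elim: m => [|m IH]; first by rewrite addn0.
  rewrite preS size_cat; have [_ [s' [e [-> _]]] _] := preF m.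
  rewrite size_rcons /=; lia.
have pre_mono m m' : m <= m' -> exists s, pre m' = pre m ++ s.
  elim: m' => [|m' IH]; first by rewrite leqn0 => /eqP ->; exists [::]; rewrite cats0.
  rewrite leq_eqVlt => /predU1P[->|]; first by exists [::]; rewrite cats0.
  rewrite ltnS => /IH[s hs].
  by exists (s ++ f (exec C0 (pre m'), pick m')); rewrite preS hs catA.
have [e0 _] : exists e : step A, True.
  by have [_ [s' [e _]] _] := preF 0; exists e.
(* Segments are nonempty, so [pre i.+1] has more than [i] steps and the default [e0] is never
   read. *)
pose e i := nth e0 (pre i.+1) i.
have eE m i : i < size (pre m) -> e i = nth e0 (pre m) i.
  move=> hi; rewrite /e; have hi' : i < size (pre i.+1).
    by apply: leq_trans (size_pre _); apply: leq_addl.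
  case: (leqP m i.+1) => [/pre_mono[s hs]|/ltnW/pre_mono[s hs]].
    by rewrite hs nth_cat hi.
  by rewrite hs nth_cat hi'.
have mkE m i : i <= size (pre m) -> mkseq e i = take i (pre m).
  move=> hi; apply: (@eq_from_nth _ e0).
    by rewrite size_mkseq size_takel.
  move=> j; rewrite size_mkseq => hj.
  by rewrite nth_mkseq // nth_take // (eE m) //; apply: leq_trans hi.
have mkP m : mkseq e (size (pre m)) = pre m by rewrite (mkE m) ?take_size.
have pre_sched' m : sched (fun=> True) C0 (pre m).
  have [s [-> hs]] := pre_sched m; apply/sched_cat.
  by split; [apply: sched_impl hs0|apply: sched_impl hs].
exists e => conf; split; last 1 first.
- move=> i; exists (size (pre i)); last by rewrite /conf mkP.
  by apply: leq_trans (size_pre i); apply: leq_addl.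
- move=> i; have hi : i < size (pre i.+1).
    by apply: leq_trans (size_pre _); apply: leq_addl.
  have [_ h1 h2] := sched_nth e0 (pre_sched' i.+1) hi.
  by rewrite /conf (mkE i.+1) 1?ltnW.
- by have := mkP 0.
- move=> i hi; have hi' : i < size (pre i.+1).
    by apply: leq_trans (size_pre _); apply: leq_addl.
  have [s [h1 h2]] := pre_sched i.+1; split.
    rewrite (eE i.+1) // h1 nth_cat ltnNge hi /=.
    rewrite h1 size_cat in hi'.
    have hi2 : i - size s0 < size s by lia.
    by have [] := sched_nth e0 h2 hi2.
  exists (take (i - size s0) s); split; last exact: sched_take.
  rewrite (mkE i.+1) 1?ltnW // h1 take_cat; case: ltnP => // ?; lia.
- split=> [p i hp|p i m hp hm].
  have [m hm hpm] := pick_inf p i hp.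
  have [_ [s' [x [hs' hx]]] _] := preF m.
  exists (size (pre m) + size s').
    apply: leq_trans hm _; apply: leq_trans (leq_addr _ _).
    by apply: leq_trans (size_pre m); apply: leq_addl.
  rewrite (eE m.+1).
    by rewrite preS hs' nth_cat ltnNge leq_addr /= addKn nth_rcons ltnn eqxx -hpm.
  by rewrite preS hs' size_cat size_rcons; lia.
  have [M hM hpM] := pick_inf p i hp.
  have hiM : i <= size (pre M).
    by apply: leq_trans hM _; apply: leq_trans (size_pre M); apply: leq_addl.
  have h1 : pre M = mkseq e i ++ drop i (pre M) by rewrite (mkE M) // cat_take_drop.
  (* Either the message is received before [pre M] ends, or it is still waiting when the next
     segment of [p] starts. *)
  have := buffer_exec (drop i (pre M)) hm.
  rewrite -exec_cat -h1 => -[|].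
    move=> /(serves_nth e0)[j]; rewrite size_drop nth_drop => -[h2 h3 h4].
    have hij : i + j < size (pre M) by rewrite -ltn_subRL.
    by exists (i + j); rewrite (eE M) // leq_addr.
  have [_ _] := preF M; rewrite /= hpM => h2.
  move=> /h2 /(serves_nth e0)[j [h3 h4 h5]]; exists (size (pre M) + j).
  have h6 : e (size (pre M) + j) = nth e0 (f (exec C0 (pre M), p)) j.
    rewrite (eE M.+1) preS hpM; last by rewrite size_cat ltn_add2l.
    by rewrite nth_cat ltnNge leq_addr addKn.
  rewrite h6; split=> //; apply: leq_trans hiM _; apply: leq_addr.
Qed.

End FairRun.

Lemma full_receive_segment ok C p (d : D) :
  ok (Step p (buffer C p) d finset.set0) ->
  fair_segment ok C p [:: Step p (buffer C p) d finset.set0].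
Proof.
move=> h; split=> [|| m hm]; last by left.
  by split=> // m.
by exists [::]; eexists.
Qed.

End Schedules.

(** * Impossibility *)

Lemma card_ord_geq n m : #|[set i : 'I_n | m <= i]%SET| = n - m.
Proof.
rewrite cardsE -sum1_card -(@big_geq_mkord _ _ _ _ _ xpredT (fun=> 1)).
by rewrite sum_nat_const_nat muln1.
Qed.

Section Impossibility.
Variables (n k : nat) (V : finType).
Hypotheses (hk2 : 2 <= k) (hkn : k.+2 <= n).
Variable A : algorithm n V ({set 'I_n} * {set 'I_n}).
Implicit Types (C : config A) (e : step A) (s : seq (step A)).
Implicit Types (P : {set 'I_n}).

(** * Uninformative detector values *)

Definition core : {set 'I_n} := [set i : 'I_n | k.-1 <= i]%SET.
Definition leaders : {set 'I_n} := [set i : 'I_n | n - k <= i]%SET.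

Lemma card_core : #|core| = n - k.-1.
Proof. exact: card_ord_geq. Qed.

Lemma card_leaders : #|leaders| = k.
Proof. by rewrite card_ord_geq; lia. Qed.

(** The ids [n - 2] and [n - 1] are leaders as [k >= 2], and core members as [k <= n - 2]; at most
    one of them is [q]. *)
Lemma leaders_core q : leaders :&: (core :\ q) <> finset.set0.
Proof.
have h (i : nat) (hi : i < n) : n - 2 <= i -> i != q -> leaders :&: (core :\ q) <> finset.set0.
  move=> h1 h2 h0; have : Ordinal hi \in leaders :&: (core :\ q).
    by rewrite !inE -val_eqE /= h2; lia.
  by rewrite h0 inE.
case: (eqVneq (n - 2 : nat) q) => hq.
  by apply: (h (n - 1)); lia.
by apply: (h (n - 2)) => //; lia.
Qed.

(** The full set is the value at crashed processes; it also serves in completions in which nobody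
    crashes. *)
Definition quorum_ok (p : 'I_n) (S : {set 'I_n}) : Prop :=
  S = [set: 'I_n]%SET \/
  if p \in core then exists a, S = core :\ a else S = [set p]%SET.

Lemma quorum_ok_inter (Q : {set 'I_n}) (S : 'I_n -> {set 'I_n}) :
  #|Q| = k.+1 -> (forall p, quorum_ok p (S p)) ->
  exists p q, p \in Q /\ q \in Q /\ p <> q /\ S p :&: S q <> finset.set0.
Proof.
move=> hQ hS.
have h2 : 1 < #|Q :&: core|.
  have h1 := cardsID core Q.
  have h3 : #|Q :\: core| <= #|~: core| by apply/subset_leq_card; rewrite finset.setDE subsetIr.
  have := cardsC core; rewrite card_core card_ord; lia.
have [p [q [hp hq hpq]]] := card_gt1P h2.
move: hp hq; rewrite !finset.in_setI => /andP[hpQ hpc] /andP[hqQ hqc].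
exists p, q; split=> //; split=> //; split; first exact/eqP.
have hsub r : r \in core -> exists a, core :\ a \subset S r.
  move=> hr; case: (hS r) => [->|]; first by exists r; apply: subsetT.
  by rewrite hr => -[a ->]; exists a.
have [a ha] := hsub p hpc; have [b hb] := hsub q hqc.
have : 0 < #|core :\ a :\ b|.
  have := cardsD1 a core; have := cardsD1 b (core :\ a); rewrite card_core; lia.
move=> /card_gt0P[c]; rewrite !inE => /and3P[hcb hca hc] h0.
have : c \in S p :&: S q.
  by rewrite inE (subsetP ha) ?(subsetP hb) // !inE ?hca ?hcb hc.
by rewrite h0 inE.
Qed.

Definition fd_ok e : Prop :=
  quorum_ok (actor e) (fd_value e).1 /\ #|(fd_value e).2| = k.

(** A step after stabilization when [P] is the set of correct processes. The condition concerns
    single steps, so such steps may be interleaved at will. *)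
Definition stable P (LD : {set 'I_n}) e : Prop :=
  [/\ actor e \in P, quorum_ok (actor e) (fd_value e).1,
      (fd_value e).1 \subset P & (fd_value e).2 = LD].

(** * From schedules to admissible runs *)

Section Admissible.
Variables (C0 : config A) (e : nat -> step A) (P LD : {set 'I_n}) (N : nat).
Hypotheses (hC0 : initial C0)
  (hleg : forall i, enabled (exec C0 (mkseq e i)) (e i) /\ omitted (e i) = finset.set0)
  (hfd : forall i, fd_ok (e i))
  (hstable : forall i, N <= i -> stable P LD (e i))
  (hinf : forall p i, p \in P -> exists2 j, i <= j & actor (e j) = p)
  (hdel : forall p i m, p \in P -> buffer (exec C0 (mkseq e i)) p m ->
     exists j, [/\ i <= j, actor (e j) = p & received (e j) m])
  (hLD : #|LD| = k) (hLDP : LD :&: P <> finset.set0)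
  (hdflt : forall p, p \in P -> exists2 S, quorum_ok p S & S \subset P).

Let r : execution A := Execution (fun i => exec C0 (mkseq e i)) e.

Lemma faulty_run : faulty (pattern_of r) = ~: P.
Proof.
apply/setP => p; rewrite !inE; apply/asboolP/idP => [[t]|hp].
  rewrite inE => /asboolP h; apply/negP => hp; apply: h.
  have [j hj1 hj2] := hinf t hp; exists j; split=> //; exact: leqW.
exists N.+1; rewrite inE; apply/asboolP => -[i []]; rewrite ltnS => hi hip.
by have [] := hstable hi; rewrite /= hip (negbTE hp).
Qed.

Lemma admissible_run :
  admissible (n - 1) (fd_pair (@Sigma n k) (@Omega n k)) r.
Proof.
have hP0 : 0 < #|P|.
  apply/card_gt0P; have [x] : exists x, x \in LD :&: P by apply/set0Pn/eqP.
  by rewrite inE => /andP[_]; exists x.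
have hS i : exec C0 (mkseq e i.+1) = next_config (exec C0 (mkseq e i)) (e i).
  by rewrite mkseqS /exec foldl_rcons.
have hPC := cardsC P; rewrite card_ord in hPC.
split; [split=> [|i]|split; [|split]].
- by [].
- have [h1 h2] := hleg i; split; first exact: h1.
  by split; [exact: hS|rewrite h2 eqxx].
- by rewrite faulty_run; lia.
- move=> i q m; rewrite faulty_run inE negbK => hq hm.
  have hb : buffer (exec C0 (mkseq e i.+1)) q m.
    by rewrite hS; right.
  by have [j [h1 h2 h3]] := hdel hq hb; exists j.
have /choice[dflt hd] : forall p, exists S, p \in P -> quorum_ok p S /\ S \subset P.
  move=> p; case: (boolP (p \in P)) => [/hdflt[S h1 h2]|_]; first by exists S.
  by exists finset.set0.
(* A history needs values at all processes and times; [base] supplies them wherever the run makes no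
   query. *)
pose base p : {set 'I_n} * {set 'I_n} :=
  (if p \in P then dflt p else [set: 'I_n]%SET, LD).
pose H p t := if t is i.+1 then if actor (e i) == p then fd_value (e i) else base p
              else base p.
have hH p t : H p t = base p \/ exists i, [/\ t = i.+1, actor (e i) = p & H p t = fd_value (e i)].
  case: t => [|i] /=; first by left.
  by case: eqP => [h|_]; [right; exists i|left].
have hbase p : quorum_ok p (base p).1.
  by rewrite /=; case: ifP => [/hd[]|_] //; left.
exists H; split; last by move=> i; rewrite /= eqxx.
split; split.
- move=> Q tau hQ; apply: (quorum_ok_inter (S := fun p => (H p (tau p)).1)) => // p.
  by case: (hH p (tau p)) => [->//|[i [_ <- ->]]]; case: (hfd i).
- split.
    exists N.+1 => t p ht; rewrite faulty_run inE negbK => hp.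
    apply/eqP; rewrite -finset.setDE finset.setD_eq0.
    case: (hH p t) => [->|[i [hi _ ->]]]; first by rewrite /= hp; case: (hd p hp).
    by rewrite hi ltnS in ht; case: (hstable ht).
  (* A process crashed at [t] takes no step at time [t'], so its value there is the default, which
     is the full set. *)
  move=> p t t' hp ht; case: (hH p t') => [->|[i [hi hip _]]].
    rewrite /= ifN //.
    have : p \in faulty (pattern_of r) by rewrite inE; apply/asboolP; exists t.
    by rewrite faulty_run inE.
  by move: hp; rewrite inE => /asboolP[]; exists i; rewrite -hi.
- move=> p t; case: (hH p t) => [->//|[i [_ _ ->]]]; by case: (hfd i).
- exists N.+1, LD; rewrite faulty_run finset.setCK; split=> // t p ht.
  case: (hH p t) => [->//|[i [hi _ ->]]].
  by rewrite hi ltnS in ht; case: (hstable ht).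
Qed.

End Admissible.

Lemma fair_admissible C0 s0 P (LD : {set 'I_n}) (Inv : config A -> Prop) :
  initial C0 -> sched fd_ok C0 s0 -> #|LD| = k -> LD :&: P <> finset.set0 ->
  Inv (exec C0 s0) ->
  (forall p, p \in P -> exists2 S, quorum_ok p S & S \subset P) ->
  (forall C p, Inv C -> p \in P ->
     exists s, fair_segment (stable P LD) C p s /\ Inv (exec C s)) ->
  exists r : execution A,
    [/\ admissible (n - 1) (fd_pair (@Sigma n k) (@Omega n k)) r,
        conf r 0 = C0, faulty (pattern_of r) = ~: P,
        (forall i, size s0 <= i -> exists s,
           conf r i = exec C0 (s0 ++ s) /\ sched (stable P LD) (exec C0 s0) s) &
        forall i, exists2 j, i <= j & Inv (conf r j)].
Proof.
move=> hC0 hs0 hLD hLDP hI hd hstep.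
have [p0 hp0] : exists p, p \in P.
  have [x] : exists x, x \in LD :&: P by apply/set0Pn/eqP.
  by rewrite inE => /andP[_]; exists x.
have [e [h1 h2 h3 [h4 h5] h6]] := fair_extension hp0 hs0 hI hstep.
have hfd i : fd_ok (e i).
  case: (leqP (size s0) i) => [/h3[[_ ? _ h] _]|hi]; first by split=> //; rewrite h.
  have [] := sched_nth (e i) hs0 hi.
  by rewrite -{1}h2 nth_mkseq.
exists (Execution (fun i => exec C0 (mkseq e i)) e).
have hst i : size s0 <= i -> stable P LD (e i) by move=> /h3[].
split=> //.
- exact: (admissible_run hC0 h1 hfd hst h4 h5 hLD hLDP hd).
- exact: (faulty_run _ hst).
- by move=> i /h3[_ [s [hs1 hs2]]]; exists s; rewrite -hs1.
Qed.

(** Makes the properties required of admissible runs available for finite schedules. After [s0]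
    every acting process receives its whole buffer. *)
Lemma completion C0 s0 P (LD : {set 'I_n}) :
  initial C0 -> sched fd_ok C0 s0 -> #|LD| = k -> LD :&: P <> finset.set0 ->
  (forall p, p \in P -> exists2 S, quorum_ok p S & S \subset P) ->
  exists r : execution A,
    [/\ admissible (n - 1) (fd_pair (@Sigma n k) (@Omega n k)) r,
        conf r 0 = C0, faulty (pattern_of r) = ~: P &
        forall i, size s0 <= i -> exists s,
          conf r i = exec C0 (s0 ++ s) /\ sched (stable P LD) (exec C0 s0) s].
Proof.
move=> hC0 hs0 hLD hLDP hd.
have [||r [h1 h2 h3 h4 _]] :=
  @fair_admissible C0 s0 P LD (fun=> True) hC0 hs0 hLD hLDP _ hd; last by exists r.
- by [].
move=> C p _ hp; have [S hS1 hS2] := hd p hp.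
exists [:: Step p (buffer C p) (S, LD) finset.set0]; split=> //.
exact: full_receive_segment.
Qed.

Lemma stable_fd_ok P (LD : {set 'I_n}) e : #|LD| = k -> stable P LD e -> fd_ok e.
Proof. by move=> h [_ h1 _ h2]; split=> //; rewrite h2. Qed.

(** * Agreement, validity and termination for finite schedules *)

Hypothesis hA : solves_set_agreement (n - 1) k (fd_pair (@Sigma n k) (@Omega n k)) A.

Lemma quorum_ok_all p : p \in [set: 'I_n]%SET ->
  exists2 S, quorum_ok p S & S \subset [set: 'I_n]%SET.
Proof. by exists [set: 'I_n]%SET; [left|]. Qed.

Lemma exec_agreement C0 s0 : initial C0 -> sched fd_ok C0 s0 ->
  #|[set v : V | `[< exists p, output (local (exec C0 s0) p) = Some v >]]%SET| <= k.
Proof.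
move=> hC0 hs0.
have hLD : leaders :&: [set: 'I_n]%SET <> finset.set0.
  by rewrite finset.setIT => h; have := card_leaders; rewrite h cards0; lia.
have [r [hr _ _ h]] := completion hC0 hs0 card_leaders hLD quorum_ok_all.
have [hag _] := hA hr; apply: leq_trans hag; apply/subset_leq_card/subsetP => v.
rewrite !inE => /asboolP[p hp]; apply/asboolP; exists p, (size s0).
by have [s [-> _]] := h _ (leqnn _); rewrite exec_cat; apply: output_exec.
Qed.

Lemma exec_validity C0 s0 p v : initial C0 -> sched fd_ok C0 s0 ->
  output (local (exec C0 s0) p) = Some v ->
  exists q, input (local C0 q) = v.
Proof.
move=> hC0 hs0 hp.
have hLD : leaders :&: [set: 'I_n]%SET <> finset.set0.
  by rewrite finset.setIT => h; have := card_leaders; rewrite h cards0; lia.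
have [r [hr h0 _ h]] := completion hC0 hs0 card_leaders hLD quorum_ok_all.
have [_ [hv _]] := hA hr; rewrite -h0; apply: hv; exists (size s0).
by have [s [-> _]] := h _ (leqnn _); rewrite exec_cat; apply: output_exec hp.
Qed.

Lemma exec_termination C0 s0 P (LD : {set 'I_n}) p :
  initial C0 -> sched fd_ok C0 s0 -> #|LD| = k -> LD :&: P <> finset.set0 ->
  (forall p, p \in P -> exists2 S, quorum_ok p S & S \subset P) ->
  p \in P ->
  exists s v, sched (stable P LD) (exec C0 s0) s /\
              output (local (exec C0 (s0 ++ s)) p) = Some v.
Proof.
move=> hC0 hs0 hLD hLDP hd hp.
have [r [hr h0 hF h]] := completion hC0 hs0 hLD hLDP hd.
have [_ [_ ht]] := hA hr.
have [|v [i hi]] := ht p; first by rewrite hF inE negbK.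
have [s [hs1 hs2]] := h _ (leq_addr i (size s0)).
exists s, v; split=> //; rewrite -hs1.
have [_ hrun] : initial (conf r 0) /\ forall i, conf r i.+1 = next_config (conf r i) (ev r i).
  by have [[h1 h2] _] := hr; split=> // j; have [_ []] := h2 j.
(* The decision at time [i] may fall within [s0]; it persists until [size s0 + i]. *)
by elim: (size s0) => //= m; rewrite addSn hrun => /output_step h'; apply: h'.
Qed.

Hypothesis hV : n <= #|V|.

Definition init_config (x : 'I_n -> V) : config A :=
  @Config _ _ _ A (fun p => LState (x p) None (init_aux A p)) (fun _ _ => False).

Lemma initial_init_config x : initial (init_config x).
Proof. by []. Qed.

Lemma cle_init C x P : initial C ->
  (forall p, p \in P -> input (local C p) = x p) -> cle P C (init_config x).
Proof.
move=> hC hx p hp; have [h1 [h2 h3]] := hC p; split; last by move=> m; rewrite h3.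
by rewrite /= -h1 -h2 -hx //; case: (local C p).
Qed.

Lemma stable_sub P P' (LD : {set 'I_n}) e : P \subset P' -> stable P LD e -> stable P' LD e.
Proof.
move=> h [h1 h2 h3 h4]; split=> //; first exact: (subsetP h).
exact: subset_trans h3 h.
Qed.

(** Running alone, [p] cannot tell [x] from the constant proposal [x p], for which validity forces
    the decision. The leaders are the [k] smallest ids, among which is [p]. *)
Lemma solo_decision (x : 'I_n -> V) (p : 'I_n) : p \notin core ->
  exists (LD : {set 'I_n}) s, [/\ #|LD| = k, sched (stable [set p]%SET LD) (init_config x) s &
    output (local (exec (init_config x) s) p) = Some (x p)].
Proof.
rewrite inE -ltnNge => hp.
pose LD : {set 'I_n} := ~: [set i : 'I_n | k <= i]%SET.
have hLD : #|LD| = k.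
  by rewrite cardsCs finset.setCK card_ord_geq card_ord; lia.
have hLDp : LD :&: [set p]%SET <> finset.set0.
  by move=> h; have : p \in LD :&: [set p]%SET; [rewrite !inE eqxx andbT; lia|rewrite h inE].
have hq q : q \in [set p]%SET -> exists2 S, quorum_ok q S & S \subset [set p]%SET.
  move=> /set1P ->; exists [set p]%SET => //; right.
  by rewrite inE leqNgt hp.
have [s [v [h1 h2]]] := exec_termination (C0 := init_config (fun=> x p)) (s0 := [::])
  (initial_init_config _) I hLD hLDp hq (set11 p).
have hv : v = x p.
  have [|q <-] := exec_validity (initial_init_config _) _ h2; last by [].
  by apply: sched_impl h1 => e; apply: stable_fd_ok.
have hc : cle [set p]%SET (init_config (fun=> x p)) (init_config x).
  by apply: cle_init => // q /set1P ->.
have [h3 h4] := cle_sched (fun e h => let: And4 h _ _ _ := h in h) hc h1.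
exists LD, s; split=> //.
by have [<- _] := h4 p (set11 p); rewrite h2 hv.
Qed.

Definition core_step := stable core leaders.

Definition reachable C : Prop :=
  exists C0 s0, [/\ initial C0, sched core_step C0 s0 & C = exec C0 s0].

(** Otherwise the [k - 1] outside processes are given pairwise different proposals other than [x]
    and [y], which the core does not notice. Run in isolation one after another, they decide these
    and bring the number of decisions to [k + 1]. *)
Lemma core_agreement C p q x y : reachable C -> p \in core -> q \in core ->
  output (local C p) = Some x -> output (local C q) = Some y -> x = y.
Proof.
move=> [C0 [s0 [hC0 hs0 ->]]] hp hq hpx hqy.
apply: contrapT => hxy.
pose S := ~: [set x; y]%SET.
have hS : k.-1 <= size (enum S).
  have := cardsC [set x; y]%SET; rewrite -/S -cardE cards2.
  have := leq_b1 (x != y); lia.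
(* The ids outside the core are [0] to [k - 2], hence valid indices into [enum S]. *)
pose v (i : 'I_n) := if i \in core then input (local C0 i) else nth x (enum S) i.
have hc : cle core C0 (init_config v).
  by apply: cle_init => // i hi; rewrite /v hi.
have [h1 h2] := cle_sched (fun e h => let: And4 h _ _ _ := h in h) hc hs0.
(* The outside processes with ids below [m] have decided; the others are still in their initial
   state, ready for a solo run. *)
have hm m : m <= k.-1 -> exists s, [/\ sched fd_ok (init_config v) s,
    output (local (exec (init_config v) s) p) = Some x,
    output (local (exec (init_config v) s) q) = Some y,
    (forall i : 'I_n, i < m -> output (local (exec (init_config v) s) i) = Some (v i)) &
    (forall i : 'I_n, i \notin core -> m <= i ->
       local (exec (init_config v) s) i = local (init_config v) i)].
  elim: m => [_|m IH hmk].
    exists s0; split=> //.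
    - by apply: sched_impl h1 => e; apply/stable_fd_ok/card_leaders.
    - by have [<- _] := h2 p hp.
    - by have [<- _] := h2 q hq.
    - move=> i hi _; apply: local_idle h1 => e [he _ _ _] hei.
      by rewrite hei (negbTE hi) in he.
  have [s [g1 g2 g3 g4 g5]] := IH (ltnW hmk).
  have hmn : m < n by lia.
  pose i0 := Ordinal hmn.
  have hi0 : i0 \notin core by rewrite inE /=; lia.
  have [LD [s1 [hLD f1 f2]]] := solo_decision v hi0.
  have hc1 : cle [set i0]%SET (init_config v) (exec (init_config v) s).
    by move=> i /set1P ->; split=> //; rewrite g5.
  have [f3 f4] := cle_sched (fun e h => let: And4 h _ _ _ := h in h) hc1 f1.
  exists (s ++ s1); rewrite exec_cat; split.
  - by apply/sched_cat; split=> //; apply: sched_impl f3 => e; apply: stable_fd_ok.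
  - exact: output_exec.
  - exact: output_exec.
  - move=> i; rewrite ltnS leq_eqVlt => /predU1P[hi|hi]; last exact/output_exec/g4.
    have -> : i = i0 by apply: val_inj.
    by have [<- _] := f4 i0 (set11 _).
  - move=> i hi him; rewrite -(g5 i hi (ltnW him)).
    apply: local_idle f3 => e [/set1P -> _ _ _] hie.
    by move: him; rewrite -hie /= ltnn.
have [s [g1 g2 g3 g4 _]] := hm _ (leqnn _).
have := exec_agreement (initial_init_config _) g1; apply/negP; rewrite -ltnNge cardE.
pose l := [:: x, y & take k.-1 (enum S)].
have hl : size l = k.+1 by rewrite /= size_takel //; lia.
rewrite -hl; apply: uniq_leq_size.
  have hn z : z \in [set x; y]%SET -> z \notin take k.-1 (enum S).
    move=> hz; apply/negP => /mem_take; rewrite mem_enum inE hz.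
    by [].
  rewrite /= take_uniq ?enum_uniq // inE negb_or !hn ?inE ?eqxx ?orbT // !andbT.
  exact/eqP.
move=> z; rewrite mem_enum !inE => /or3P[/eqP->|/eqP->|hz]; apply/asboolP.
- by exists p.
- by exists q.
have [i hi <-] := nthP x hz.
rewrite size_takel // in hi; rewrite nth_take //.
have hin : i < n by lia.
exists (Ordinal hin); rewrite g4 // /v inE /=; case: leqP => //; lia.
Qed.

(** * Bivalence within the core *)

Definition can_decide C (v : V) : Prop :=
  exists s p, [/\ sched core_step C s, p \in core &
                 output (local (exec C s) p) = Some v].

Definition bivalent C : Prop := exists u v, [/\ u <> v, can_decide C u & can_decide C v].

Lemma reachable_exec C s : reachable C -> sched core_step C s -> reachable (exec C s).
Proof.
move=> [C0 [s0 [h1 h2 ->]]] hs; exists C0, (s0 ++ s); split=> //; last by rewrite exec_cat.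
exact/sched_cat.
Qed.

(* Both [X] and [Y] follow the decision of a run from [C] in which [q] has
   crashed; this replaces the commutation of steps, which fails for buffers
   that are sets. *)
Lemma can_decide_common C X Y q : reachable C -> cle (core :\ q) C X ->
  cle (core :\ q) C Y -> exists v, can_decide X v /\ can_decide Y v.
Proof.
move=> [C0 [s0 [hC0 hs0 hC]]] hX hY.
have hne : exists p, p \in core :\ q.
  have [p] : exists p, p \in leaders :&: (core :\ q) by apply/set0Pn/eqP/leaders_core.
  by rewrite inE => /andP[_]; exists p.
have [p hp] := hne.
have hq i : i \in core :\ q -> exists2 S, quorum_ok i S & S \subset core :\ q.
  by rewrite inE => /andP[_ hi]; exists (core :\ q) => //; right; rewrite hi; exists q.
have hs0' : sched fd_ok C0 s0.
  by apply: sched_impl hs0 => e; apply/stable_fd_ok/card_leaders.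
have [s [v [h1 h2]]] := exec_termination hC0 hs0' card_leaders (@leaders_core q) hq hp.
rewrite exec_cat -hC in h1 h2.
have hcore e : stable (core :\ q) leaders e -> core_step e.
  exact/stable_sub/finset.subD1set.
have hpc : p \in core by move: hp; rewrite inE => /andP[].
exists v; split.
- have [h3 h4] := cle_sched (fun e h => let: And4 h _ _ _ := h in h) hX h1.
  exists s, p; split=> //; first exact: sched_impl h3.
  by have [<- _] := h4 p hp.
- have [h3 h4] := cle_sched (fun e h => let: And4 h _ _ _ := h in h) hY h1.
  exists s, p; split=> //; first exact: sched_impl h3.
  by have [<- _] := h4 p hp.
Qed.

(** The proposals change from all [x] to all [y] one process at a time, and neighbouring
    configurations share a decision value. Without bivalence [x] would be passed on to the end,
    against validity. *)
Lemma initial_bivalent : exists C0, initial C0 /\ bivalent C0.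
Proof.
apply: contrapT => hno.
have [x [y [_ _ hxy]]] : exists x y : V, [/\ x \in predT, y \in predT & x != y].
  have /card_gt1P : 1 < #|{: V}| by lia.
  by move=> [x [y [? ? ?]]]; exists x, y.
pose I m := init_config (fun i : 'I_n => if i < m then y else x).
have hI m : reachable (I m) by exists (I m), [::].
have hv m : m <= n -> can_decide (I m) x.
  elim: m => [_|m IH hm].
    (* For two equal configurations this says merely that some value can be decided. *)
    have [v [hv _]] := can_decide_common (hI 0) (q := Ordinal (leq_trans (ltn0Sn _) hkn))
      (fun p hp => conj erefl (fun m h => h)) (fun p hp => conj erefl (fun m h => h)).
    have [s [p [h1 h2 h3]]] := hv; suff -> : x = v by [].
    have [|q /= <-//] := exec_validity (initial_init_config _) _ h3.
    by apply: sched_impl h1 => e; apply/stable_fd_ok/card_leaders.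
  have [v [v1 v2]] : exists v, can_decide (I m) v /\ can_decide (I m.+1) v.
    apply: (can_decide_common (hI m) (q := Ordinal hm)) => p; first by [].
    rewrite !inE -val_eqE /= => /andP[hp _]; split=> //=.
    by rewrite ltnS (leq_eqVlt p) (negbTE hp).
  suff -> : x = v by [].
  apply: contrapT => hxv; apply: hno; exists (I m); split=> //.
  by exists x, v; split=> //; apply: IH; apply: ltnW.
have [s [p [h1 h2 h3]]] := hv n (leqnn n).
have [|q /= hq] := exec_validity (initial_init_config _) _ h3.
  by apply: sched_impl h1 => e; apply/stable_fd_ok/card_leaders.
by move: hxy; rewrite -hq ltn_ord eqxx.
Qed.

Lemma core_quorum p : p \in core ->
  exists2 S, quorum_ok p S & S \subset core.
Proof.
by exists (core :\ p); [right; rewrite H; exists p|apply: finset.subD1set].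
Qed.

(** If every fair segment for [p] destroys bivalence, then letting [p] receive its buffer at [C]
    fixes a value [u]. Take a schedule [t] from [C] that decides some [w <> u]. Along the prefixes
    of [t] the value fixed by such a step of [p] remains [u], since consecutive prefixes share
    decision values; but after all of [t] it must be [w]. *)
Lemma bivalent_extension C p : reachable C -> bivalent C -> p \in core ->
  exists s, fair_segment core_step C p s /\ bivalent (exec C s).
Proof.
move=> hC hbiv hp; apply: contrapT => hno.
have [S hS1 hS2] := core_quorum hp.
pose rcv C' L := Step p L (S, leaders) finset.set0 : step A.
pose e C' := rcv C' (buffer C' p).
(* The last step may leave messages in the buffer, as long as all those pending in [C] are received
   by then. *)
have hseg s L : sched core_step C s ->
    (forall m, L m -> buffer (exec C s) p m) ->
    (forall m, buffer C p m -> serves C p s m \/ L m) ->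
    fair_segment core_step C p (rcons s (rcv (exec C s) L)).
  move=> h1 h2 h3; split; first by rewrite -cats1; apply/sched_cat.
    by exists s, (rcv (exec C s) L).
  move=> m /h3 [h|h]; rewrite -cats1; apply/serves_cat; first by left.
  by right; left.
have hnb s L : sched core_step C s ->
    (forall m, L m -> buffer (exec C s) p m) ->
    (forall m, buffer C p m -> serves C p s m \/ L m) ->
    forall u v, can_decide (next_config (exec C s) (rcv (exec C s) L)) u ->
                can_decide (next_config (exec C s) (rcv (exec C s) L)) v -> u = v.
  move=> h1 h2 h3 u v hu hv; apply: contrapT => huv; apply: hno.
  exists (rcons s (rcv (exec C s) L)); split; first exact: hseg.
  by exists u, v; rewrite /exec foldl_rcons.
have cle_e s L q : q = p -> cle (core :\ q) (exec C s) (next_config (exec C s) (rcv (exec C s) L)).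
  by move=> ->; apply: cle_other_step; rewrite !inE eqxx.
have full s m : buffer C p m -> serves C p s m \/ buffer (exec C s) p m by exact: buffer_exec.
have [u [_ hu]] : exists u, can_decide C u /\ can_decide (next_config C (e C)) u.
  apply: (can_decide_common hC (q := p)) => //; exact: (cle_e [::]).
have [w [hwu [t [q [ht hq hqw]]]]] : exists w, w <> u /\ can_decide C w.
  have [a [b [hab ha hb]]] := hbiv; case: (eqVneq a u) => [hau|/eqP h].
    by exists b; split=> // hbu; apply: hab; rewrite hau hbu.
  by exists a.
have hall s t' : t = s ++ t' -> can_decide (next_config (exec C s) (e (exec C s))) u.
  elim/last_ind: s t' => [//|s e' IH] t' hst.
  have {}IH := IH (e' :: t') (etrans hst (cat_rcons _ _ _)).
  have : sched core_step C (rcons s e') by have := ht; rewrite hst => /sched_cat[].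
  move=> hse; have : sched core_step C (s ++ [:: e']) by rewrite cats1.
  move=> /sched_cat[hs /= [he' hen hom _]].
  set C0 := exec C s in IH he' hen *.
  have hC1 : exec C (rcons s e') = next_config C0 e' by rewrite /exec foldl_rcons.
  have hrC0 : reachable C0 by apply: reachable_exec.
  have hrC1 : reachable (exec C (rcons s e')) by apply: reachable_exec.
  (* If [e'] is a step of [p], all states compared look like [C0] to the rest of the core. *)
  have [hqp|hqp] := eqVneq (actor e') p.
    have [v [hv1 hv2]] : exists v, can_decide (next_config C0 (e C0)) v /\
        can_decide (next_config (exec C (rcons s e')) (e (exec C (rcons s e')))) v.
      apply: (can_decide_common hrC0 (q := p)); first exact: cle_e.
      apply: (@cle_trans _ _ _ _ _ _ (exec C (rcons s e'))); last exact: cle_e.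
      by rewrite hC1; apply: cle_other_step; rewrite !inE hqp eqxx.
    by rewrite (hnb s _ hs (fun m h => h) (full s) u v).
  (* In [Y], [p] receives only what it could have received before [e']; so [Y]
     shares a decision value with the successors on both sides of [e']. *)
  pose Y := next_config (exec C (rcons s e')) (rcv (exec C (rcons s e')) (buffer C0 p)).
  have hL m : buffer C0 p m -> buffer (exec C (rcons s e')) p m.
    by move=> hm; rewrite hC1; left; split=> // -[h _]; rewrite h eqxx in hqp.
  have hYnb : forall a b, can_decide Y a -> can_decide Y b -> a = b.
    apply: hnb => // m /(full s)[h|h]; last by right.
    by left; rewrite -cats1; apply/serves_cat; left.
  have [v [hv1 hv2]] : exists v, can_decide (next_config C0 (e C0)) v /\ can_decide Y v.
    have hr : reachable (next_config C0 (e C0)).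
      by apply: (reachable_exec (s := [:: e C0])) => //=; split.
    apply: (can_decide_common hr (q := actor e')) => // i; rewrite !inE => /andP[hi _].
    have hia : i <> actor e' by apply/eqP.
    rewrite /Y hC1; split=> /=.
      by rewrite (negbTE hi); case: eqP => // ->.
    move=> m [[hm1 hm2]|hm]; first by left; split=> //; left; split=> // -[].
    right; move: hm; rewrite /sent /=.
    by rewrite eq_sym (negbTE hqp).
  have [v' [hv1' hv2']] : exists v, can_decide Y v /\
      can_decide (next_config (exec C (rcons s e')) (e (exec C (rcons s e')))) v.
    by apply: (can_decide_common hrC1 (q := p)); apply: cle_e.
  by rewrite (hnb s _ hs (fun m h => h) (full s) u v) // (hYnb v v').
have {}hall := hall t [::] (esym (cats0 t)).
apply: hwu; apply: (hnb t _ ht (fun m h => h) (full t)) => //.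
by exists [::], q; split=> //; apply: output_step.
Qed.

(** A fair run of the core returns to bivalent configurations forever. Once a core process has
    decided, [core_agreement] makes every reachable decision equal to that one. *)
Lemma set_agreement_impossible : False.
Proof.
have [C0 [hC0 hb0]] := initial_bivalent.
have hr0 : reachable C0 by exists C0, [::].
have hL : leaders :&: core <> finset.set0.
  move=> h; apply: (@leaders_core (Ordinal (leq_trans (ltn0Sn _) hkn))).
  by apply/eqP; rewrite -finset.subset0 -h finset.setIS // finset.subD1set.
have [|r [h1 h2 h3 h4 h5]] := fair_admissible (Inv := fun C => reachable C /\ bivalent C)
  (s0 := [::]) hC0 I card_leaders hL (conj hr0 hb0) core_quorum.
  move=> C p [hC hb] hp; have [s [hs1 hs2]] := bivalent_extension hC hb hp.
  by exists s; split=> //; split=> //; apply: reachable_exec => //; case: hs1.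
have [_ [_ hterm]] := hA h1.
have [p] : exists p, p \in leaders :&: core by apply/set0Pn/eqP.
rewrite inE => /andP[_ hp].
have [|v [i hi]] := hterm p; first by rewrite h3 inE negbK.
have [j hij [hr [x [y [hxy [s [q [s1 s2 s3]]] [s' [q' [s1' s2' s3']]]]]]]] := h5 i.
have hj : output (local (conf r j) p) = Some v.
  have hrun m : conf r m.+1 = next_config (conf r m) (ev r m).
    by have [[_ h] _] := h1; have [_ []] := h m.
  rewrite -(subnK hij); elim: (j - i) => //= m h; rewrite addSn hrun.
  exact: output_step.
apply: hxy; transitivity v.
- exact: (core_agreement (reachable_exec hr s1) s2 hp s3 (output_exec _ hj)).
- exact: (core_agreement (reachable_exec hr s1') hp s2' (output_exec _ hj) s3').
Qed.

End Impossibility.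

(** * Admissible runs *)

Section AdmissibleRuns.
Variables (n : nat) (V : finType) (D : Type) (A : algorithm n V D).
Variables (f : nat) (X : failure_detector n D) (r : execution A).
Hypothesis hr : admissible f X r.

Lemma conf_step i : conf r i.+1 = next_config (conf r i) (ev r i).
Proof. by have [[_ h] _] := hr; have [_ []] := h i. Qed.

Lemma local_step i p : local (conf r i.+1) p =
  if p == actor (ev r i)
  then trans p (local (conf r i) p) (received (ev r i)) (fd_value (ev r i))
  else local (conf r i) p.
Proof. by rewrite conf_step. Qed.

Lemma received_buffer i m : received (ev r i) m ->
  buffer (conf r i) (actor (ev r i)) m.
Proof. by have [[_ h] _] := hr; have [h' _] := h i; apply: h'. Qed.

Lemma output_mono i j p v : i <= j ->
  output (local (conf r i) p) = Some v -> output (local (conf r j) p) = Some v.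
Proof.
move=> /subnK <- h; elim: (j - i) => //= m; rewrite addSn conf_step.
exact: output_step.
Qed.

Lemma correct_acts p t : p \notin faulty (pattern_of r) ->
  exists2 i, t <= i & actor (ev r i) = p.
Proof.
move=> hp; apply: contrapT => h; move/negP: hp; apply.
rewrite inE; apply/asboolP; exists t.+1; rewrite inE; apply/asboolP => -[i [hi hip]].
by apply: h; exists i.
Qed.

(** An omission would make the step the last one of its sender, but a correct sender acts again. *)
Lemma correct_sends i q m : actor (ev r i) \notin faulty (pattern_of r) ->
  q \notin faulty (pattern_of r) ->
  send (actor (ev r i)) (local (conf r i) (actor (ev r i))) (received (ev r i)) (q, m) ->
  exists j, [/\ i < j, actor (ev r j) = q & received (ev r j) m].
Proof.
move=> ha hq hm; have [[_ hrun] [_ [hdel _]]] := hr.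
have [|j [h1 [h2 h3]]] := hdel i q m hq; last by exists j.
split=> //; have [_ [_ hom]] := hrun i.
have [->|/hom h] := eqVneq (omitted (ev r i)) finset.set0; first by rewrite inE.
by have [j hj /(h j hj)] := correct_acts i.+1 ha.
Qed.

End AdmissibleRuns.

(** * Loneliness *)

Section Lonely.
Variables (n : nat) (V : finType).
Hypothesis hn : 2 <= n.

(* [(Some p, x)] is a proposal of [p], [(None, v)] a decision. *)
Definition lonely_msg : Type := (option 'I_n * V)%type.

Definition adoptable (p : 'I_n) (L : set lonely_msg) (m : lonely_msg) : Prop :=
  L m /\ if m.1 is Some j then j < p else True.

Definition lonely_trans (p : 'I_n) (s : lstate V unit) (L : set lonely_msg)
    (d : {set 'I_n} * {set 'I_n}) : lstate V unit :=
  if output s is Some _ then s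
  else if d.1 \subset [set p]%SET then LState (input s) (Some (input s)) tt
  else if pselect (exists m, adoptable p L m) is left h
    then LState (input s) (Some (projT1 (cid h)).2) tt
  else s.

Definition lonely_send (p : 'I_n) (s : lstate V unit) (L : set lonely_msg) :
    set ('I_n * lonely_msg) :=
  fun qm => qm.2 = (Some p, input s) \/
            exists2 v, output s = Some v & qm.2 = (None, v).

Lemma lonely_write_once p s L d v :
  output s = Some v -> output (lonely_trans p s L d) = Some v.
Proof. by rewrite /lonely_trans => h; rewrite {1}h. Qed.

Definition lonely_algorithm : algorithm n V ({set 'I_n} * {set 'I_n}) :=
  Algorithm (fun _ => tt) lonely_send lonely_write_once.

Section Run.
Variable r : execution lonely_algorithm.
Hypothesis hr : admissible (n - 1) (fd_pair (@Sigma n (n - 1)) (@Omega n (n - 1))) r.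
Notation st i p := (local (conf r i) p).
Notation x p := (input (st 0 p)).

Lemma lonely_input i p : input (st i p) = x p.
Proof.
elim: i => // i <-; rewrite (local_step hr); case: eqP => // _.
rewrite /= /lonely_trans; case: (output _) => //; case: ifP => // _.
by case: pselect.
Qed.

(** The three ways to decide: lonely, by a smaller proposal, by a decision. In the last case two
    different processes share a decision. *)
Definition lonely_origin (i : nat) (p : 'I_n) (v : V) : Prop :=
  [\/ v = x p /\ (exists2 j, actor (ev r j) = p & (fd_value (ev r j)).1 \subset [set p]%SET),
      (exists2 j : 'I_n, j < p & v = x j) |
      exists2 q, q <> p & output (st i q) = Some v].

Lemma lonely_invariant i :
  (forall q j v, buffer (conf r i) q (Some j, v) -> v = x j) /\
  (forall q v, buffer (conf r i) q (None, v) -> exists p, output (st i p) = Some v) /\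
  (forall p v, output (st i p) = Some v -> lonely_origin i p v /\ exists q, v = x q).
Proof.
elim: i => [|i [IH1 [IH2 IH3]]].
  have [[h0 _] _] := hr; split=> [q j v|]; first by have [_ [_ ->]] := h0 q.
  split=> [q v|p v]; first by have [_ [_ ->]] := h0 q.
  by have [-> _] := h0 p.
have mono p v : output (st i p) = Some v -> output (st i.+1 p) = Some v.
  exact: (output_mono hr).
split; [|split].
- move=> q j v; rewrite (conf_step hr) => -[[/IH1]//|[[]]] /=.
    by move=> [-> ->] _; exact: lonely_input.
  by move=> [].
- move=> q v; rewrite {1}(conf_step hr) => -[[/IH2[p hp] _]|[[]//]].
    by exists p; apply: mono.
  by move=> [w hw [->]] _; exists (actor (ev r i)); apply: mono.
- have lift p v : lonely_origin i p v -> lonely_origin i.+1 p v.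
    case=> [h|h|[q h1 h2]]; [by apply: Or31|by apply: Or32|apply: Or33].
    by exists q => //; apply: mono.
  move=> p v; rewrite (local_step hr); case: eqP => [hp|_]; last first.
    by move=> /IH3[/lift].
  rewrite /= /lonely_trans; case ho: (output (st i p)) => [w|].
    by rewrite ho => -[<-]; have [/lift] := IH3 _ _ ho.
  case: ifP => [hl [<-]|_].
    rewrite lonely_input; split; last by exists p.
    by apply: Or31; split=> //; exists i; rewrite // -hp.
  case: pselect => [h [<-]|]; last by rewrite ho.
  case: cid => -[[j|] w] /= [hL hj].
    have -> : w = x j by apply: (IH1 p); rewrite hp; apply: (received_buffer hr).
    by split; [apply: Or32; exists j|exists j].
  have [|q hq] := IH2 p w; first by rewrite hp; apply: (received_buffer hr).
  have [_ hx] := IH3 _ _ hq; split=> //; apply: Or33; exists q; last exact: mono.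
  by move=> hqp; rewrite hqp ho in hq.
Qed.

Lemma lonely_valid p v : decides r p v -> exists q, x q = v.
Proof.
move=> [i hi]; have [_ [_ h]] := lonely_invariant i.
by have [_ [q ->]] := h _ _ hi; exists q.
Qed.

Lemma decides_functional p v w : decides r p v -> decides r p w -> v = w.
Proof.
move=> [i hi] [j hj].
have := output_mono hr (leq_maxl i j) hi.
by rewrite (output_mono hr (leq_maxr i j) hj) => -[].
Qed.

(* With [n] decided values nobody adopts a decision and, by induction on ids,
   nobody adopts a smaller proposal: every process is lonely at some time,
   against the intersection property. *)
Lemma lonely_agreement :
  #|[set v : V | `[< exists p, decides r p v >]]%SET| <= n - 1.
Proof.
set S := [set v | _]%SET; rewrite leqNgt; apply/negP => hS.
have /choice[y hy] : forall p, exists o : option V,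
    if o is Some v then decides r p v else forall v, ~ decides r p v.
  move=> p; case: (pselect (exists v, decides r p v)) => [[v hv]|h].
    by exists (Some v).
  by exists None => v hv; apply: h; exists v.
have hyd p v : decides r p v -> y p = Some v.
  move=> hv; have := hy p; case: (y p) => [w hw|/(_ v)//].
  by rewrite (decides_functional hv hw).
(* At least [n] values are decided by [n] processes; hence all of them decide, and [y] is
   injective. *)
have hsub : [set Some v | v in S]%SET \subset [set y p | p in 'I_n]%SET.
  apply/subsetP => o /imsetP[v]; rewrite inE => /asboolP[p /hyd hp] ->.
  by apply/imsetP; exists p.
have hcS : #|[set Some v | v in S]%SET| = #|S| by apply/card_imset/Some_inj.
have hcy : #|[set y p | p in 'I_n]%SET| <= n.
  by rewrite -[X in _ <= X]card_ord; apply: leq_imset_card.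
have heq : [set Some v | v in S]%SET = [set y p | p in 'I_n]%SET.
  by apply/eqP; rewrite eqEcard hsub hcS; lia.
have /imset_injP hI : #|[set y p | p in 'I_n]%SET| == #|'I_n|.
  by rewrite card_ord eqn_leq hcy -heq hcS /=; lia.
have hinj : injective y by move=> p q; apply: hI.
have hdec p : exists2 v, y p = Some v & decides r p v.
  have : y p \in [set Some v | v in S]%SET by rewrite heq imset_f.
  move=> /imsetP[v _ hv]; exists v => //; by have := hy p; rewrite hv.
have horig p v : decides r p v ->
    (v = x p /\ (exists2 j, actor (ev r j) = p & (fd_value (ev r j)).1 \subset [set p]%SET))
    \/ exists2 j : 'I_n, j < p & v = x j.
  move=> hv; have [i hi] := hv; have [_ [_ h]] := lonely_invariant i.
  have [[?|?|[q hqp hq]] _] := h _ _ hi; [by left|by right|].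
  case: hqp; apply: hinj; rewrite (hyd _ _ hv); apply: hyd; by exists i.
have hx m (p : 'I_n) : p < m -> y p = Some (x p).
  elim: m p => // m IH p; rewrite ltnS => hpm.
  have [v hv hd] := hdec p; rewrite hv.
  have [[-> _]//|[j hj hvj]] := horig _ _ hd.
  have /hinj hjp : y j = y p by rewrite hv hvj; apply: IH; apply: leq_trans hpm.
  by rewrite hjp ltnn in hj.
have hlone p : exists2 j, actor (ev r j) = p & (fd_value (ev r j)).1 \subset [set p]%SET.
  have [v hv hd] := hdec p; have [[_ //]|[j hj hvj]] := horig _ _ hd.
  have /hinj hjp : y j = y p by rewrite hv hvj; apply: hx (ltn_ord j).
  by rewrite hjp ltnn in hj.
have [_ [_ [_ [H [[[hint _] _] hH]]]]] := hr.
have /choice[t ht] : forall p, exists t, (H p t).1 \subset [set p]%SET.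
  by move=> p; have [j <- hj] := hlone p; exists j.+1; rewrite -hH.
have [|p [q [_ [_ [hpq]]]]] := hint [set: 'I_n]%SET t.
  by rewrite cardsT card_ord; lia.
apply; apply/setP => z; rewrite !inE; apply/negP => /andP[hz1 hz2].
move: (subsetP (ht p) _ hz1) (subsetP (ht q) _ hz2); rewrite !inE.
by move=> /eqP h1 /eqP h2; apply: hpq; rewrite -h1 -h2.
Qed.

Lemma lonely_decides_next i p v : actor (ev r i) = p ->
  adoptable p (received (ev r i)) v -> exists w, output (st i.+1 p) = Some w.
Proof.
move=> hp hv; rewrite (local_step hr) hp eqxx /= /lonely_trans.
case ho: (output (st i p)) => [w|]; first by exists w.
case: ifP => _; first by eexists.
by case: pselect => [h|[]]; [eexists|exists v].
Qed.

(** Of two correct processes the one with the larger id receives the proposal of the other and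
    decides, and its decision then reaches the other. If [p] is the only correct process, its quorum
    eventually contains no other process. *)
Lemma lonely_termination p : p \notin faulty (pattern_of r) -> exists v, decides r p v.
Proof.
move=> hp; case: (pselect (exists2 q, q <> p & q \notin faulty (pattern_of r))).
- have adopt (a b : 'I_n) : a < b -> a \notin faulty (pattern_of r) ->
      b \notin faulty (pattern_of r) -> exists v i, output (st i b) = Some v.
    move=> hab ha hb; have [i _ hi] := correct_acts 0 ha.
    have [||j [hj1 hj2 hj3]] := correct_sends hr (i := i) (m := (Some a, x a)) _ hb.
    - by rewrite hi.
    - by left; rewrite /= hi (lonely_input i).
    have [|v hv] := lonely_decides_next (v := (Some a, x a)) hj2; first by split.
    by exists v, j.+1.
  move=> [q hqp hq]; case: (ltngtP q p) => [hlt|hlt|/val_inj//].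
    by have [v [i hi]] := adopt _ _ hlt hq hp; exists v, i.
  have [v [i hi]] := adopt _ _ hlt hp hq.
  have [j hij hj] := correct_acts i hq.
  have [||l [h1 h2 h3]] := correct_sends hr (i := j) (m := (None, v)) _ hp.
  - by rewrite hj.
  - by right; exists v => //; rewrite hj; apply: (output_mono hr) hi.
  have [|w hw] := lonely_decides_next (v := (None, v)) h2; first by split.
  by exists w, l.+1.
- move=> hno; have [_ [_ [_ [H [[[_ [[t ht] _]] _] hH]]]]] := hr.
  have [i hti hi] := correct_acts t hp.
  case ho: (output (st i p)) => [w|]; first by exists w, i.
  have hl : (fd_value (ev r i)).1 \subset [set p]%SET.
    apply/subsetP => z hz; rewrite inE.
    apply/eqP; apply: contrapT => hzp; apply: hno; exists z => //; apply/negP => hzF.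
    have := ht i.+1 p (leqW hti) hp; rewrite -hi -hH => /setP/(_ z).
    by rewrite finset.in_setI hz hzF inE.
  exists (x p), i.+1; rewrite (local_step hr) hi eqxx /= /lonely_trans ho hl /=.
  by rewrite (lonely_input i).
Qed.

End Run.

Lemma lonely_solves :
  solves_set_agreement (n - 1) (n - 1)
    (fd_pair (@Sigma n (n - 1)) (@Omega n (n - 1))) lonely_algorithm.
Proof.
move=> r hr; split; first exact: lonely_agreement.
by split; [exact: lonely_valid|exact: lonely_termination].
Qed.

End Lonely.

(** * Paxos *)

Lemma eventually_forall (I : finType) (P : I -> nat -> Prop) :
  (forall q, exists N, forall i, N <= i -> P q i) ->
  exists N, forall i, N <= i -> forall q, P q i.
Proof.
move=> /choice[N hN]; exists (\max_q N q) => i hi q; apply: hN.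
exact: leq_trans (leq_bigmax q) hi.
Qed.

Lemma ex_maximum (P : nat -> Prop) (B : nat) :
  (exists i, P i) -> (forall i, P i -> i <= B) ->
  exists2 m, P m & forall i, P i -> i <= m.
Proof.
move=> [i hi] hB.
have hex : exists i, `[< P i >] by exists i; apply/asboolP.
have hB' j : `[< P j >] -> j <= B by move=> /asboolP/hB.
case: (ex_maxnP hex hB') => m /asboolP hm hmax; exists m => // j hj.
by apply: hmax; apply/asboolP.
Qed.

Lemma bounded_stabilizes (u : nat -> nat) (B : nat) :
  (forall i j, i <= j -> u i <= u j) -> (forall i, u i <= B) ->
  exists N, forall i, N <= i -> u i = u N.
Proof.
move=> hu hB; have [||m [N hN] hm] := @ex_maximum (fun v => exists i, u i = v) B.
- by exists (u 0), 0.
- by move=> _ [i <-].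
exists N => i hi; apply/eqP; rewrite eqn_leq (hu _ _ hi) hN hm //.
by exists i.
Qed.

Section Paxos.
Variables (n : nat) (V : finType).
Hypothesis hn : 2 <= n.
Notation fd := ({set 'I_n} * {set 'I_n})%type.

Record report : Type := Report {
  sender : 'I_n;
  promised : nat;
  accepted : nat;
  estimate : V }.

Record paxos_state : Type := PaxosState {
  ballot : nat;
  vote : nat;
  choice_of : option V;
  heard : set report }.

(* In ballot 0, which nobody leads, every process has accepted its own input. *)
Definition value (s : lstate V paxos_state) : V := odflt (input s) (choice_of (aux s)).

Definition report_of (p : 'I_n) (s : lstate V paxos_state) : report :=
  Report p (ballot (aux s)) (vote (aux s)) (value s).

(** Residues modulo [n] give each positive ballot exactly one owner. *)
Definition owns (p : 'I_n) (b : nat) : bool := (0 < b) && (b %% n == p).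

Definition fresh_ballot (p : 'I_n) (b : nat) : nat := (b %/ n).+1 * n + p.

Lemma fresh_ballot_gt p b : b < fresh_ballot p b.
Proof.
rewrite /fresh_ballot mulSn {1}(divn_eq b n).
have : b %% n < n by rewrite ltn_mod; lia.
lia.
Qed.

Lemma fresh_ballot_le p b : fresh_ballot p b <= b + n + n.
Proof.
rewrite /fresh_ballot mulSn; have := leq_divM b n; have := ltn_ord p; lia.
Qed.

Lemma owns_fresh p b : owns p (fresh_ballot p b).
Proof.
rewrite /owns (leq_ltn_trans (leq0n _) (fresh_ballot_gt p b)) /=.
by rewrite /fresh_ballot modnMDl modn_small.
Qed.

Definition promise_quorum (K : set report) (Q : {set 'I_n}) (b : nat) : Prop :=
  forall q, q \in Q -> exists m, [/\ K m, sender m = q & promised m = b].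

Definition best_report (K : set report) (b : nat) (m : report) : Prop :=
  [/\ K m, promised m = b &
      forall m', K m' -> promised m' = b -> accepted m' <= accepted m].

Definition catch_up (K : set report) (b : nat) (m : report) : Prop :=
  K m /\ b < promised m.
Definition follow (K : set report) (b v : nat) (m : report) : Prop :=
  [/\ K m, accepted m = b & v < b].
Definition lead (K : set report) (Q : {set 'I_n}) p (b v : nat) (m : report) : Prop :=
  [/\ owns p b, v < b, promise_quorum K Q b & best_report K b m].

(** Following precedes leading: an owner that leads has heard of no vote in [b], so that its best
    report stems from a smaller ballot. *)
Definition paxos_update (K : set report) (Q LD : {set 'I_n}) (p : 'I_n)
    (b v : nat) (w : V) : nat * nat * V :=
  if pselect (exists m, catch_up K b m) is left h
    then (promised (projT1 (cid h)), v, w)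
  else if (p \in LD) && ~~ owns p b then (fresh_ballot p b, v, w)
  else if pselect (exists m, follow K b v m) is left h
    then (b, b, estimate (projT1 (cid h)))
  else if pselect (exists m, lead K Q p b v m) is left h
    then (b, b, estimate (projT1 (cid h)))
  else (b, v, w).

Inductive paxos_update_spec (K : set report) (Q LD : {set 'I_n}) (p : 'I_n)
    (b v : nat) (w : V) : nat -> nat -> V -> Prop :=
| CatchUp m of catch_up K b m :
    paxos_update_spec K Q LD p b v w (promised m) v w
| NewBallot of p \in LD & ~~ owns p b :
    paxos_update_spec K Q LD p b v w (fresh_ballot p b) v w
| Follow m of (forall m, ~ catch_up K b m) & ~~ ((p \in LD) && ~~ owns p b)
    & follow K b v m :
    paxos_update_spec K Q LD p b v w b b (estimate m)
| Lead m of (forall m, ~ catch_up K b m) & ~~ ((p \in LD) && ~~ owns p b)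
    & (forall m, ~ follow K b v m) & lead K Q p b v m :
    paxos_update_spec K Q LD p b v w b b (estimate m)
| Stay of (forall m, ~ catch_up K b m) & ~~ ((p \in LD) && ~~ owns p b)
    & (forall m, ~ follow K b v m) & (forall m, ~ lead K Q p b v m) :
    paxos_update_spec K Q LD p b v w b v w.

Lemma paxos_updateP K Q LD p b v w :
  let u := paxos_update K Q LD p b v w in
  paxos_update_spec K Q LD p b v w u.1.1 u.1.2 u.2.
Proof.
rewrite /paxos_update /=; case: pselect => [h|/forallNP h1].
  by apply: CatchUp; case: (cid h).
case: ifPn => [/andP[h2 h3]|h2]; first exact: NewBallot.
case: pselect => [h|/forallNP h3]; first by apply: Follow => //; case: (cid h).
case: pselect => [h|/forallNP h4]; first by apply: Lead => //; case: (cid h).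
exact: Stay.
Qed.

(** Ballot 0 is excluded because its votes, the inputs, may differ. *)
Definition decision_quorum (K : set report) (Q : {set 'I_n}) (bv : nat * V) : Prop :=
  0 < bv.1 /\
  forall q, q \in Q ->
    exists m, [/\ K m, sender m = q, accepted m = bv.1 & estimate m = bv.2].

Definition paxos_decision (K : set report) (Q : {set 'I_n}) : option V :=
  if pselect (exists bv, decision_quorum K Q bv) is left h
    then Some (projT1 (cid h)).2 else None.

(* Only quorums of distinct processes are known to intersect, so every process
   adds itself to its quorums. *)
Definition paxos_trans (p : 'I_n) (s : lstate V paxos_state) (L : set report)
    (d : fd) : lstate V paxos_state :=
  let K := (heard (aux s) `|` L)%classic in
  let Q := p |: d.1 in
  let u := paxos_update K Q d.2 p (ballot (aux s)) (vote (aux s)) (value s) in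
  LState (input s) (if output s is Some v then Some v else paxos_decision K Q)
    (PaxosState u.1.1 u.1.2 (Some u.2) K).

Definition paxos_send (p : 'I_n) (s : lstate V paxos_state) (L : set report) :
    set ('I_n * report) := fun qm => qm.2 = report_of p s.

Lemma paxos_write_once p s L d v :
  output s = Some v -> output (paxos_trans p s L d) = Some v.
Proof. by move=> /= ->. Qed.

Definition paxos : algorithm n V fd :=
  Algorithm (fun _ => PaxosState 0 0 None (fun _ => False)) paxos_send paxos_write_once.

Section Run.
Variable r : execution paxos.
Hypothesis hr : admissible (n - 1) (fd_pair (@Sigma n 1) (@Omega n 1)) r.
Notation st i p := (local (conf r i) p).
Notation bal i p := (ballot (aux (st i p))).
Notation vot i p := (vote (aux (st i p))).
Notation est i p := (value (st i p)).
Notation kno i p := (heard (aux (st i p))).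
Notation quo i := (actor (ev r i) |: (fd_value (ev r i)).1).
Notation correct p := (p \notin faulty (pattern_of r)).

(** * Safety of Paxos *)

Lemma paxos_initial p : [/\ bal 0 p = 0, vot 0 p = 0, est 0 p = input (st 0 p),
  forall m, ~ kno 0 p m & output (st 0 p) = None].
Proof. by have [[h _] _] := hr; have [h1 [h2 _]] := h p; split; rewrite /value ?h2 //= => m. Qed.

Lemma idle_step i p : p <> actor (ev r i) -> st i.+1 p = st i p.
Proof. by move=> /eqP/negbTE h; rewrite (local_step hr) h. Qed.

Lemma kno_mono i j p m : i <= j -> kno i p m -> kno j p m.
Proof.
move=> /subnK <- h; elim: (j - i) => //= l IH; rewrite addSn (local_step hr).
by case: eqP => // _; left.
Qed.

Lemma active_step i p : actor (ev r i) = p ->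
  paxos_update_spec (kno i.+1 p) (quo i) (fd_value (ev r i)).2 p
    (bal i p) (vot i p) (est i p) (bal i.+1 p) (vot i.+1 p) (est i.+1 p).
Proof.
move=> <-; rewrite (local_step hr) eqxx /= /value /=.
exact: paxos_updateP.
Qed.

(** Reports are snapshots of their sender. For heard reports the snapshot is strictly earlier, which
    drives the inductions on time. *)
Lemma report_origin i :
  (forall q m, buffer (conf r i) q m ->
     exists2 j, j <= i & m = report_of (sender m) (st j (sender m))) /\
  (forall q m, kno i q m ->
     exists2 j, j < i & m = report_of (sender m) (st j (sender m))).
Proof.
elim: i => [|i [IH1 IH2]]; split=> q m.
- by have [[h _] _] := hr; have [_ [_ ->]] := h q.
- by have [_ _ _ h _] := paxos_initial q => /h.
- rewrite (conf_step hr) => -[[/IH1[j hj hm] _]|[hm _]].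
    by exists j => //; apply: leqW.
  have {}hm : m = report_of (actor (ev r i)) (st i (actor (ev r i))) := hm.
  by exists i => //; rewrite hm.
- have lift : (exists2 j, j < i & m = report_of (sender m) (st j (sender m))) ->
      exists2 j, j < i.+1 & m = report_of (sender m) (st j (sender m)).
    by move=> [j hj hm]; exists j => //; apply: leqW.
  rewrite (local_step hr); case: eqP => [hq|_]; last by move=> /IH2/lift.
  by move=> [/IH2/lift//|/(received_buffer hr)/IH1].
Qed.

Lemma kno_origin i q m : kno i q m ->
  exists j, [/\ j < i, promised m = bal j (sender m),
    accepted m = vot j (sender m) & estimate m = est j (sender m)].
Proof.
by have [_ h] := report_origin i => /h[j hj ->]; exists j.
Qed.

Lemma vot_le_bal i p : vot i p <= bal i p.
Proof.
elim: i => [|i IH]; first by have [-> ->] := paxos_initial p.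
have [/esym hp|hp] := eqVneq p (actor (ev r i)); last by rewrite (idle_step (elimN eqP hp)).
case: (active_step hp) => //= [m [_ h]|_ _].
  exact: leq_trans IH (ltnW h).
by apply: leq_trans IH (ltnW _); apply: fresh_ballot_gt.
Qed.

Lemma bal_step i p : bal i p <= bal i.+1 p /\
  ((vot i.+1 p = vot i p /\ est i.+1 p = est i p) \/ bal i p <= vot i.+1 p).
Proof.
have [/esym hp|/eqP hp] := eqVneq p (actor (ev r i)); last first.
  by rewrite idle_step //; split=> //; left.
case: (active_step hp) => [m [_ h]|_ _|m _ _ _|m _ _ _ _|_ _ _ _] /=.
- by split; [apply: ltnW|left].
- by split; [apply/ltnW/fresh_ballot_gt|left].
- by split=> //; right.
- by split=> //; right.
- by split=> //; left.
Qed.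

Lemma bal_mono i j p : i <= j -> bal i p <= bal j p.
Proof.
move=> /subnK <-; elim: (j - i) => //= l IH; rewrite addSn.
by apply: leq_trans IH _; have [] := bal_step (l + i) p.
Qed.

(** The force of a promise: any new vote after time [i] is cast in a ballot no smaller than the one
    promised at [i]. *)
Lemma vot_stable i j p : i <= j ->
  (vot j p = vot i p /\ est j p = est i p) \/ bal i p <= vot j p.
Proof.
move=> /subnK <-; elim: (j - i) => [|l IH]; first by left.
rewrite addSn; have [_ [[-> ->] //|h]] := bal_step (l + i) p.
by right; apply: leq_trans h; apply: bal_mono; apply: leq_addl.
Qed.

Lemma vot_mono i j p : i <= j -> vot i p <= vot j p.
Proof.
move=> /(vot_stable p)[[-> _]//|h]; exact: leq_trans (vot_le_bal _ _) h.
Qed.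

(** The event that the owner of [b] casts its vote there, with a value inherited from a smaller
    ballot. *)
Definition proposal i b w : Prop :=
  let p := actor (ev r i) in
  let K := kno i.+1 p in
  [/\ owns p b, vot i p < b, vot i.+1 p = b /\ est i.+1 p = w,
      exists m, [/\ best_report K b m, accepted m < b & estimate m = w] &
      promise_quorum K (quo i) b].

(** Votes spread by following reports of earlier votes, so each positive one traces back to the
    owner of its ballot. *)
Lemma vote_proposal i p : 0 < vot i p -> exists j, proposal j (vot i p) (est i p).
Proof.
elim: i {-2}i (leqnn i) p => [|i IH] j hj p.
  by move: hj; rewrite leqn0 => /eqP ->; have [_ -> _ _ _] := paxos_initial p.
move: hj; rewrite leq_eqVlt => /predU1P[->|]; last by move=> hj; apply: IH.
have [/esym hp|/eqP hp] := eqVneq p (actor (ev r i)); last first.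
  by rewrite idle_step //; apply: IH.
have own_vote : 0 < vot i p -> exists l, proposal l (vot i p) (est i p) by apply: IH.
have hK m : kno i.+1 p m -> 0 < accepted m -> exists l, proposal l (accepted m) (estimate m).
  by move=> /kno_origin[l [hl _ -> ->]]; apply: IH.
have hmx m : kno i.+1 p m -> accepted m <= promised m.
  by move=> /kno_origin[l [_ -> -> _]]; apply: vot_le_bal.
have hpr b w m : vot i.+1 p = b /\ est i.+1 p = w -> lead (kno i.+1 p) (quo i) p b (vot i p) m ->
    (forall m, ~ follow (kno i.+1 p) b (vot i p) m) -> estimate m = w -> proposal i b w.
  move=> h1 [h2 h3 h4 h5] h6 h7; rewrite hp in h4; rewrite /proposal hp; split=> //.
  exists m; split=> //; have [g1 g2 _] := h5; rewrite ltn_neqAle -{2}g2 hmx // andbT.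
  by apply/eqP => h; apply: (h6 m).
move: hpr; case: (active_step hp) => [m _|_ _|m _ _ [h1 h2 _]|m _ _ hf hl|_ _ _ _] hpr //.
- by move=> h; rewrite -h2 in h *; apply: hK.
- by move=> _; exists i; apply: hpr hl _ _.
Qed.

(** The owner is determined by [b], and its vote, which never decreases, rises to [b] only once. *)
Lemma proposal_unique i j b w w' : proposal i b w -> proposal j b w' -> w = w'.
Proof.
wlog hij : i j w w' / i <= j => [hw|].
  by case: (leqP i j) => [|/ltnW] h h1 h2; [|symmetry]; apply: hw h _ _; eassumption.
move=> [/andP[_ /eqP o1] _ [v1 e1] _ _] [/andP[_ /eqP o2] lt2 [_ e2] _ _].
have hp : actor (ev r i) = actor (ev r j) by apply: val_inj; rewrite /= -o1 -o2.
move: hij; rewrite leq_eqVlt => /predU1P[hij|hij].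
  by rewrite -e1 -e2 hij.
by have := vot_mono (actor (ev r i)) hij; rewrite v1 hp leqNgt lt2.
Qed.

(** A run carries no history, only the existence of one; so the quorum is given by its process and
    time, for every history that fits the run. *)
Definition chosen b w : Prop :=
  exists p t, 0 < b /\ forall H, fd_pair (@Sigma n 1) (@Omega n 1) (pattern_of r) H ->
    (forall i, fd_value (ev r i) = H (actor (ev r i)) i.+1) ->
    forall q, q \in p |: (H p t).1 -> exists j, vot j q = b /\ est j q = w.

Lemma decision_chosen p w : decides r p w -> exists b, chosen b w.
Proof.
move=> [i]; elim: i => [|i IH]; first by have [_ _ _ _ ->] := paxos_initial p.
rewrite (local_step hr); case: eqP => // hp; rewrite /=.
case ho : (output (st i p)) => [v|]; first by rewrite -{1}ho.
rewrite /paxos_decision; case: pselect => // h [<-].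
case: (cid h) => -[b v] /= [hb hq]; exists b, p, i.+1; split=> // H _ hH q.
have -> : H p i.+1 = fd_value (ev r i) by rewrite hp hH.
move=> /hq[m [hm <- /= <- <-]].
have hk : kno i.+1 p m by rewrite (local_step hr) {1}hp eqxx.
by have [j [_ _ -> ->]] := kno_origin hk; exists j.
Qed.

(* Induction on [b]: a member of both quorums voted for [w] at [b'] before it
   promised [b], so the best report seen by the leader of [b] is at [b'] or
   later. *)
Lemma proposal_chosen b' w i b v :
  chosen b' w -> b' <= b -> proposal i b v -> v = w.
Proof.
move=> hc; elim/ltn_ind: b i v => b IH i v hb hp.
have hc' := hc; move: hc' => [p' [t [hb' hq]]].
have [_ [_ [_ [H [hH hfd]]]]] := hr.
have {}hq := hq H hH hfd.
have vote_w q j : vot j q = b' -> est j q = w -> exists l, proposal l b' w.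
  by move=> h1 h2; have := @vote_proposal j q; rewrite h1 h2; apply.
move: hb; rewrite leq_eqVlt => /predU1P[hbb|hlt].
  have [|j [h1 h2]] := hq p'; first by rewrite !inE eqxx.
  have [l hl] := vote_w _ _ h1 h2.
  by rewrite -hbb in hp; apply: proposal_unique hp hl.
have [_ _ _ [m [[hm hmb hmax] hma hmv]] hprom] := hp.
set p := actor (ev r i) in hm hmax hprom.
have [q hq1 hq2] : exists2 q, q \in p |: (H p i.+1).1 & q \in p' |: (H p' t).1.
  have [->|hpp] := eqVneq p p'; first by exists p'; rewrite !inE eqxx.
  have [[hint _] _] := hH.
  have [|a [c [ha [hc' [hac hi]]]]] :=
    hint [set p; p']%SET (fun x => if x == p then i.+1 else t).
    by rewrite cards2 hpp.
  have [z] : exists z, z \in (H a (if a == p then i.+1 else t)).1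
      :&: (H c (if c == p then i.+1 else t)).1 by apply/set0Pn/eqP.
  rewrite inE => /andP[]; move: ha hc'; rewrite !inE.
  have hpp' : (p' == p) = false by rewrite eq_sym (negbTE hpp).
  move=> /orP[]/eqP ha /orP[]/eqP hc'; try by case: hac; rewrite ha hc'.
    by rewrite ha hc' eqxx hpp' => h1 h2; exists z; rewrite !inE ?h1 ?h2 orbT.
  by rewrite ha hc' eqxx hpp' => h1 h2; exists z; rewrite !inE ?h1 ?h2 orbT.
have [j [hj1 hj2]] := hq q hq2.
have [|m' [hm' hsm' hpm']] := hprom q; first by rewrite hfd -/p.
have hacc : b' <= accepted m.
  apply: leq_trans (hmax _ hm' hpm').
  have [l [_ hl1 -> _]] := kno_origin hm'; rewrite hsm' hpm' in hl1 *.
  case: (leqP j l) => hjl; first by rewrite -hj1; apply: vot_mono.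
  have [[<- _]|] := vot_stable q (ltnW hjl); first by rewrite hj1.
  by rewrite -hl1 hj1 leqNgt hlt.
have [l [_ _ hl2 hl3]] := kno_origin hm.
have [|l' hl'] := @vote_proposal l (sender m).
  by rewrite -hl2; apply: leq_trans hacc.
rewrite -hl2 -hl3 hmv in hl'.
exact: IH hl'.
Qed.

Lemma paxos_agreement p q v w : decides r p v -> decides r q w -> v = w.
Proof.
move=> /decision_chosen[b hb] /decision_chosen[c hc].
have prop b' w' : chosen b' w' -> exists i, proposal i b' w'.
  move=> [p' [t [hb0 hq]]]; have [_ [_ [_ [H [hH hfd]]]]] := hr.
  have [|j [h1 h2]] := hq H hH hfd p'; first by rewrite !inE eqxx.
  by have := @vote_proposal j p'; rewrite h1 h2; apply.
have [i hi] := prop _ _ hb; have [j hj] := prop _ _ hc.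
case: (leqP b c) => [hbc|/ltnW hcb].
  by symmetry; apply: proposal_chosen hb hbc hj.
exact: proposal_chosen hc hcb hi.
Qed.

Lemma est_input i p : exists q, est i p = input (st 0 q).
Proof.
elim: i {-2}i (leqnn i) p => [|i IH] j hj p.
  by move: hj; rewrite leqn0 => /eqP ->; have [_ _ -> _ _] := paxos_initial p; exists p.
move: hj; rewrite leq_eqVlt => /predU1P[->|]; last by move=> hj; apply: IH.
have [/esym hp|hp] := eqVneq p (actor (ev r i)); last first.
  by rewrite (idle_step (elimN eqP hp)); apply: IH.
have hK m : kno i.+1 p m -> exists q, estimate m = input (st 0 q).
  by move=> /kno_origin[l [hl _ _ ->]]; apply: IH.
case: (active_step hp) => [m _|_ _|m _ _ [h _ _]|m _ _ _ [_ _ _ [h _ _]]|_ _ _ _];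
  solve [exact: IH|exact: hK].
Qed.

Lemma paxos_validity p v : decides r p v -> exists q, input (st 0 q) = v.
Proof.
move=> /decision_chosen[b [p' [t [hb hq]]]].
have [_ [_ [_ [H [hH hfd]]]]] := hr.
have [|j [_ <-]] := hq H hH hfd p'; first by rewrite !inE eqxx.
by have [q ->] := est_input j p'; exists q.
Qed.

(** * Termination of Paxos *)

Lemma correct_reports p q N : correct p -> correct q ->
  exists i j, N <= i /\ kno j q (report_of p (st i p)).
Proof.
move=> hp hq; have [i hNi hip] := correct_acts N hp.
have [||j [hj1 hj2 hj3]] := correct_sends hr (i := i)
  (m := report_of p (st i p)) _ hq; [by rewrite hip|by rewrite /= hip|].
exists i, j.+1; split=> //; rewrite (local_step hr) hj2 eqxx; by right.
Qed.

(** A report with a larger ballot would make [p] raise its own ballot at its next step. *)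
Lemma no_catch_up p c N i m : correct p -> (forall i, N <= i -> bal i p = c) ->
  kno i p m -> promised m <= c.
Proof.
move=> hp hc hm; have [j hj hjp] := correct_acts (maxn i N) hp.
have hNj : N <= j by apply: leq_trans (leq_maxr _ _) hj.
have hij : i <= j.+1 by apply: leqW; apply: leq_trans (leq_maxl _ _) hj.
rewrite leqNgt -(hc j hNj); apply/negP => hlt.
have hbb : bal j.+1 p = bal j p by rewrite !hc // leqW.
move: hbb; have hcu : catch_up (kno j.+1 p) (bal j p) m.
  by split=> //; apply: kno_mono hm.
case: (active_step hjp) => [m' [_ h]|_ _|m' h|m' h|h]; try by case: (h m).
- by move=> e; rewrite e ltnn in h.
- by move=> e; have := fresh_ballot_gt p (bal j p); rewrite e ltnn.
Qed.

Section Leader.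
Variables (l : 'I_n) (T : nat).
Hypotheses (hl : correct l)
  (hT : forall i, T <= i -> (fd_value (ev r i)).2 = [set l]%SET).

(** After [T] only [l] opens ballots, and only from one it does not own, that is, from at most [B],
    the largest ballot at [T]. The opened ballot is below [B + n + n] or equal to it, by
    [fresh_ballot_le]. *)
Lemma ballot_bounded : exists B, forall i p, T <= i ->
  bal i p <= B + n + n /\ (bal i p <= B \/ owns l (bal i p)).
Proof.
exists (\max_p bal T p); set B := \max_p _.
have hB j p : j <= T -> bal j p <= B.
  by move=> /(bal_mono p) h; apply: leq_trans h (leq_bigmax p).
elim/ltn_ind => i IH p hi.
have [hiT|hiT] := leqP i T.
  by split; [|left]; [rewrite -addnA; apply/(leq_trans (hB i p hiT))/leq_addr|apply: hB].
case: i hiT hi IH => // i; rewrite ltnS => hiT _ IH.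
have [/esym hp|hp] := eqVneq p (actor (ev r i)); last first.
  by rewrite (idle_step (elimN eqP hp)); apply: IH.
have hIH := IH i (ltnSn i) p hiT.
case: (active_step hp) => [m [/kno_origin[j [hj -> _ _]] _]|hpl hno|//|//|//].
  have [hjT|/ltnW hjT] := leqP j T; last exact: IH.
  by split; [|left]; [rewrite -addnA; apply/(leq_trans (hB _ _ hjT))/leq_addr|apply: hB].
move: hpl hno; rewrite hT // inE => /eqP -> hno; split; last by right; apply: owns_fresh.
apply: leq_trans (fresh_ballot_le _ _) _.
have [_ [h|h]] := IH i (ltnSn i) l hiT; last by rewrite h in hno.
by rewrite !leq_add2r.
Qed.

(** Being bounded, the ballot of [l] becomes constant; if [l] did not own it, its next step would
    raise it. *)
Lemma leader_ballot : exists b N, [/\ T <= N, owns l b & forall i, N <= i -> bal i l = b].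
Proof.
have [B hB] := ballot_bounded.
have [||N hN] := @bounded_stabilizes (fun i => bal (T + i) l) (B + n + n).
- by move=> i j hij; apply: bal_mono; rewrite leq_add2l.
- by move=> i; have [] := hB (T + i) l (leq_addr _ _).
have hN' i : T + N <= i -> bal i l = bal (T + N) l.
  move=> hi; have := hN (i - T); rewrite subnKC; last exact: leq_trans (leq_addr _ _) hi.
  by apply; rewrite leq_subRL //; apply: leq_trans (leq_addr _ _) hi.
exists (bal (T + N) l), (T + N); split=> //; first exact: leq_addr.
have [j hj hjl] := correct_acts (T + N) hl.
have hlead : l \in (fd_value (ev r j)).2.
  by rewrite hT ?inE //; apply: leq_trans (leq_addr _ _) hj.
have hbb : bal j.+1 l = bal j l by rewrite !hN' // leqW.
rewrite -(hN' j hj); apply/negPn/negP => hno.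
move: hbb; have hno' : (l \in (fd_value (ev r j)).2) && ~~ owns l (bal j l) by rewrite hlead.
case: (active_step hjl) => [m' [_ h]|_ _|m' _ h|m' _ h|_ h]; try by rewrite hno' in h.
- by move=> e; rewrite e ltnn in h.
- by move=> e; have := fresh_ballot_gt l (bal j l); rewrite e ltnn.
Qed.

(** The ballot of each correct process becomes constant too. It and [l] hear of each other, so
    neither final ballot exceeds the other. *)
Lemma common_ballot : exists b N, [/\ T <= N, owns l b &
  forall i, N <= i -> forall q, correct q -> bal i q = b].
Proof.
have [b [N [hTN hb hN]]] := leader_ballot; have [B hB] := ballot_bounded.
have [M hM] : exists M, forall i, M <= i -> forall q, correct q -> bal i q = b.
  apply: eventually_forall => q; case: (boolP (correct q)) => hq; last by exists 0.
  have [||M hM] := @bounded_stabilizes (fun i => bal (T + i) q) (B + n + n).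
  - by move=> i j hij; apply: bal_mono; rewrite leq_add2l.
  - by move=> i; have [] := hB (T + i) q (leq_addr _ _).
  have hM' i : T + M <= i -> bal i q = bal (T + M) q.
    move=> hi; have := hM (i - T); rewrite subnKC; last exact: leq_trans (leq_addr _ _) hi.
    by apply; rewrite leq_subRL //; apply: leq_trans (leq_addr _ _) hi.
  exists (T + M) => i hi _; rewrite hM' //; apply/eqP; rewrite eqn_leq.
  have [i1 [j1 [h1 /(no_catch_up hl hN)]]] := correct_reports (T + M) hq hl.
  rewrite /= hM' // => ->.
  have [i2 [j2 [h2 /(no_catch_up hq hM')]]] := correct_reports N hl hq.
  by rewrite /= hN.
exists b, (maxn N M); split=> //; first exact: leq_trans hTN (leq_maxl _ _).
by move=> i hi q hq; apply: hM => //; apply: leq_trans (leq_maxr _ _) hi.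
Qed.

(** Quorums eventually contain only correct processes, whose promises of [b] all reach [l]; so [l]
    votes in [b]. The other correct processes hear of this vote and follow. *)
Lemma common_vote : exists b N, [/\ T <= N, 0 < b &
  forall i, N <= i -> forall q, correct q -> vot i q = b].
Proof.
have [b [N [hTN hb hN]]] := common_ballot.
have [_ [_ [_ [H [[[_ [[tS hS] _]] _] hfd]]]]] := hr.
have hquo i p : tS <= i -> correct p -> actor (ev r i) = p ->
    forall q, q \in quo i -> correct q.
  move=> hi hp hip q; rewrite hip hfd hip finset.in_setU1 => /predU1P[->//|hq].
  apply/negP => hqF; have := hS i.+1 p (leqW hi) hp => /setP/(_ q).
  by rewrite finset.in_setI hq hqF inE.
have after p i : N <= i -> correct p -> vot i p = b -> forall j, i <= j -> vot j p = b.
  move=> hi hp hv j hij; apply/eqP; rewrite eqn_leq -{2}hv vot_mono // andbT.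
  by rewrite -(hN j _ p hp) ?vot_le_bal //; apply: leq_trans hij.
have [i0 hi0 hv0] : exists2 i, N <= i & vot i l = b.
  apply: contrapT => hno.
  have hvl i : N <= i -> vot i l < b.
    move=> hi; rewrite ltn_neqAle -{2}(hN i hi l hl) vot_le_bal andbT.
    by apply/eqP => hv; apply: hno; exists i.
  have [M hM] : exists M, forall i, M <= i -> forall q, correct q ->
      exists m, [/\ kno i l m, sender m = q & promised m = b].
    apply: eventually_forall => q; case: (boolP (correct q)) => hq; last by exists 0.
    have [i [j [hi hj]]] := correct_reports N hq hl.
    exists j => i' hi' _; exists (report_of q (st i q)).
    by split=> //=; [apply: kno_mono hj|apply: hN].
  have [i hi hil] := correct_acts (maxn (maxn N M) tS) hl.
  move: hi; rewrite !geq_max => /andP[/andP[hNi hMi] hSi].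
  have hv1 := hvl i.+1 (leqW hNi); have hb1 := hN i.+1 (leqW hNi) l hl.
  have hv := hvl i hNi; have hbi := hN i hNi l hl.
  move: hv1 hb1; case: (active_step hil) => [m [_ h]|_ h|m _ _ _|m _ _ _ _|hcu _ _ hld] hv1 hb1.
  - by rewrite hb1 hbi ltnn in h.
  - by rewrite hbi hb in h.
  - by rewrite hbi ltnn in hv1.
  - by rewrite hbi ltnn in hv1.
  (* Infinitely many reports might have been heard; a best one exists because accepted ballots are
     at most [b]. *)
  have [||a [m [hm1 hm2 <-]] ha] := @ex_maximum
    (fun a => exists m, [/\ kno i.+1 l m, promised m = b & accepted m = a]) b.
  - by have [m [h1 _ h2]] := hM i.+1 (leqW hMi) l hl; exists (accepted m), m.
  - move=> a [m [/kno_origin[j [_ -> -> _]] <- <-]]; exact: vot_le_bal.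
  apply: (hld m); rewrite hbi; split=> //.
    by move=> q hq; apply: hM; [exact: leqW|exact: hquo hil q hq].
  by split=> // m' h1 h2; apply: ha; exists m'.
have [M hM] : exists M, forall i, M <= i -> forall q, correct q -> vot i q = b.
  apply: eventually_forall => q; case: (boolP (correct q)) => hq; last by exists 0.
  have [i [j [hi hj]]] := correct_reports i0 hl hq.
  have [i' hi' hiq] := correct_acts (maxn j N) hq.
  move: hi'; rewrite geq_max => /andP[hji hNi].
  exists i'.+1 => i2 hi2 _; apply: (after _ i'.+1 _ hq _ _ hi2); first exact: leqW.
  have hbi := hN i' hNi q hq; have hb1 := hN i'.+1 (leqW hNi) q hq.
  have [hv|hv] := eqVneq (vot i' q) b; first exact: (after _ _ hNi hq hv).
  have hvb : vot i' q < b by rewrite ltn_neqAle hv -hbi vot_le_bal.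
  have hf : follow (kno i'.+1 q) (bal i' q) (vot i' q) (report_of l (st i l)).
    split; [exact: kno_mono (leqW hji) hj| |by rewrite hbi].
    by rewrite /= hbi; exact: (after _ _ hi0 hl hv0).
  move: hb1; case: (active_step hiq) => [m [_ h]|h h'|m _ _ _|m _ _ h|_ _ h] hb1;
    try by case: (h _ hf).
  - by rewrite hb1 hbi ltnn in h.
  - move: h h'; rewrite hT; last exact: leq_trans hNi.
    by rewrite inE => /eqP ->; rewrite (hN _ hNi) // hb.
  - by [].
exists b, (maxn N M); split; first exact: leq_trans hTN (leq_maxl _ _).
  by case/andP: hb.
by move=> i hi q hq; apply: hM => //; apply: leq_trans (leq_maxr _ _) hi.
Qed.

(** Votes in the common ballot agree by [proposal_unique]; once reports of them from all correct
    processes have arrived, any later quorum of [p] is a decision quorum. *)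
Lemma leader_termination p : correct p -> exists v, decides r p v.
Proof.
move=> hp; have [b [N [_ hb hN]]] := common_vote.
have [_ [_ [_ [H [[[_ [[tS hS] _]] _] hfd]]]]] := hr.
have hval i q : N <= i -> correct q -> est i q = est N l.
  move=> hi hq; have [|j1 hj1] := @vote_proposal i q; first by rewrite hN.
  have [|j2 hj2] := @vote_proposal N l; first by rewrite hN.
  by rewrite hN // in hj1; rewrite hN // in hj2; apply: proposal_unique hj1 hj2.
have [M hM] : exists M, forall i, M <= i -> forall q, correct q ->
    exists m, [/\ kno i p m, sender m = q, accepted m = b & estimate m = est N l].
  apply: eventually_forall => q; case: (boolP (correct q)) => hq; last by exists 0.
  have [i [j [hi hj]]] := correct_reports N hq hp.
  exists j => i' hi' _; exists (report_of q (st i q)).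
  by split=> //=; [apply: kno_mono hj|apply: hN|apply: hval].
have [i hi hip] := correct_acts (maxn M tS) hp.
move: hi; rewrite geq_max => /andP[hMi hSi].
case ho : (output (st i p)) => [w|]; first by exists w, i.
suff [bv hbv] : exists bv, decision_quorum (kno i.+1 p) (quo i) bv.
  have : exists v, output (st i.+1 p) = Some v.
    rewrite (local_step hr) hip eqxx /= ho /paxos_decision.
    case: pselect => [h|[]]; first by eexists.
    by exists bv; move: hbv; rewrite (local_step hr) hip eqxx.
  by move=> [v hv]; exists v, i.+1.
exists (b, est N l); split=> // q hq; apply: hM; first exact: leqW.
move: hq; rewrite hip hfd hip finset.in_setU1 => /predU1P[->//|hq].
apply/negP => hqF; have := hS i.+1 p (leqW hSi) hp => /setP/(_ q).
by rewrite finset.in_setI hq hqF inE.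
Qed.

End Leader.

Lemma paxos_termination p : correct p -> exists v, decides r p v.
Proof.
have [_ [_ [_ [H [[_ [hk [T [LD [hLD hT]]]]] hfd]]]]] := hr.
have /eqP/cards1P[l hl] : #|LD| = 1 by rewrite -(hT T p (leqnn T)) hk.
have hcl : correct l.
  apply/negP => h; apply: hLD; apply/setP => z; rewrite hl !inE.
  by apply/negP => /andP[/eqP ->]; move: h; rewrite inE => ->.
apply: (@leader_termination l T) => // i hi.
by rewrite hfd (hT _ _ (leqW hi)).
Qed.

End Run.

Lemma paxos_solves :
  solves_set_agreement (n - 1) 1 (fd_pair (@Sigma n 1) (@Omega n 1)) paxos.
Proof.
move=> r hr; split; last by split; [exact: paxos_validity|exact: paxos_termination].
apply/card_le1P => v; rewrite inE => /asboolP[p hp] w; rewrite !inE.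
apply/asboolP/eqP => [[q hq]|->]; last by exists p.
exact: paxos_agreement hr _ _ _ _ hq hp.
Qed.

End Paxos.

(** * The characterization *)

Theorem corollary13 (n k : nat) (V : finType)
    (hn : 2 <= n) (hk : 1 <= k <= n - 1) (hV : n <= #|V|) :
  (exists A : algorithm n V ({set 'I_n} * {set 'I_n}),
     solves_set_agreement (n - 1) k (fd_pair (@Sigma n k) (@Omega n k)) A)
  <-> (k = 1 \/ k = n - 1).
Proof.
split=> [[A hA]|[hk1|hk1]].
- case: (ltngtP k 1) => hk1; [lia| |by left].
  right; apply: contrapT => hkn.
  have hkn2 : k.+2 <= n by lia.
  exact: set_agreement_impossible hk1 hkn2 A hA hV.
- by rewrite hk1; exists (paxos n V); apply: paxos_solves.
- by rewrite hk1; exists (lonely_algorithm n V); apply: lonely_solves.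
Qed.
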